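(* Let $m\ge3$ and let $p_0(t)=|\psi_0(t)|^2$ be the probability of the return to the root at time $t$ for the nearest-neighbor continuous-time quantum walk on the $m$-valent infinite homogeneous tree $\mathbb{T}_m$ started at the root. Then, as $t\to\infty$, $$p_0(t)=\frac{m^2(m-1)^{1/2}}{\pi(m-2)^4}\,\frac1{t^3}\,\sin^2\!\left[\left(2\sqrt{m-1}\right)t-\pi/4\right]+O\!\left(t^{-7/2}\right).$$
   Context: $\mathbb{T}_m$ is the infinite tree in which every vertex has valency $m$, with a distinguished vertex $e$ (the root). $X$ is the adjacency operator of $\mathbb{T}_m$, a bounded self-adjoint operator on $L^2(\mathbb{T}_m)=\ell^2$ of the vertex set; $\delta_e$ is the delta function at $e$. The nearest-neighbor quantum walk has evolution $U_t=\exp(itX)$, and $\psi_0(t)=\langle\delta_e,U_t\delta_e\rangle$ is the amplitude of return to the root. *)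

(* Defs.v *)
From HB Require Import structures.
From mathcomp Require Import all_boot all_order all_algebra.
From mathcomp Require Import complex.
From mathcomp Require Import all_classical all_reals all_analysis.

Set Implicit Arguments.
Unset Strict Implicit.
Unset Printing Implicit Defensive.

Import Order.TTheory GRing.Theory Num.Theory.
Import numFieldNormedType.Exports.

Local Open Scope classical_set_scope.
Local Open Scope complex_scope.
Local Open Scope ring_scope.

(* The tree T_m is given, up to isomorphism, as any simple graph satisfying
   [regular_tree m]; such a graph is automatically infinite when m >= 2. *)
Section graph.
Variables (V : choiceType) (adj : rel V).

Definition graph_connected : Prop :=
  forall v w : V, exists p : seq V, path adj v p /\ last v p = w.

(* [ucycle] also accepts the sequences [:: v; w] with v, w adjacent, which
   are not cycles of a simple graph. *)
Definition graph_acyclic : Prop :=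
  forall c : seq V, (2 < size c)%N -> ~ ucycle adj c.

Definition graph_regular (m : nat) : Prop :=
  forall v : V, ([set w | adj v w] #= `I_m)%card.

Definition regular_tree (m : nat) : Prop :=
  [/\ symmetric adj, irreflexive adj,
      graph_connected, graph_acyclic & graph_regular m].

End graph.

(* Operators on l^2(V) are represented by maps on all of V -> R[i]; only their
   restriction to [l2] is relevant. *)
Section l2.
Variables (R : realType) (V : choiceType).
Implicit Types (f g : V -> R[i]) (A U : (V -> R[i]) -> (V -> R[i])).

Definition l2norm f : \bar R :=
  ((\esum_(v in [set: V]) (Normc.normc (f v) ^+ 2)%:E) `^ 2^-1)%E.

Definition l2 : set (V -> R[i]) := [set f | (l2norm f < +oo)%E].

(* Unordered sums of absolutely summable families. *)
Definition real_sum (h : V -> R) : R :=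
  fine (\esum_(v in [set: V]) (Num.max (h v) 0)%:E
        - \esum_(v in [set: V]) (Num.max (- h v) 0)%:E)%E.

Definition complex_sum f : R[i] :=
  real_sum (fun v => complex.Re (f v)) +i* real_sum (fun v => complex.Im (f v)).

Definition inner f g : R[i] := complex_sum (fun v => conjc (f v) * g v).

Definition delta (e : V) : V -> R[i] := fun v => (v == e)%:R.

(* Equal to +oo when A does not map l^2 boundedly into itself. *)
Definition opnorm A : \bar R :=
  ereal_inf [set c%:E | c in [set c : R | 0 <= c /\
    forall f, l2 f -> (l2norm (A f) <= c%:E * l2norm f)%E]].

Definition opexp_partial A (n : nat) : (V -> R[i]) -> (V -> R[i]) :=
  fun f v => \sum_(k < n) (k`!%:R)^-1 * iter k A f v.

Definition is_opexp A U : Prop :=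
  opnorm (fun f v => U f v - opexp_partial A n f v) @[n --> \oo] --> 0%E.

(* exp(A), the sum of the exponential series in operator norm; the limit is
   unique on l^2. *)
Definition opexp A : (V -> R[i]) -> (V -> R[i]) := xget (fun f => f) (is_opexp A).

End l2.

Section quantum_walk.
Variables (R : realType) (V : choiceType) (adj : rel V).

Definition adjacency (f : V -> R[i]) : V -> R[i] :=
  fun v => \sum_(w \in [set w | adj v w]) f w.

Definition evolution (t : R) : (V -> R[i]) -> (V -> R[i]) :=
  opexp (fun f v => 'i%C * t%:C * adjacency f v).

Definition return_amplitude (e : V) (t : R) : R[i] :=
  inner (@delta R V e) (evolution t (@delta R V e)).

Definition return_probability (e : V) (t : R) : R :=
  Normc.normc (return_amplitude e t) ^+ 2.

End quantum_walk.

(* Main.v *)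
Require Import Defs.
From mathcomp Require Import all_boot all_order all_algebra.
From mathcomp Require Import complex.
From mathcomp Require Import all_classical all_reals all_analysis.
From mathcomp Require Import ring lra.

Import Order.TTheory GRing.Theory Num.Theory.
Import numFieldNormedType.Exports.

Local Open Scope classical_set_scope.
Local Open Scope ring_scope.

(** By radiality the k-th moment of the adjacency operator at the root is
    (1/pi) \int_0^pi (2 sqrt q cos u)^k w(u) du, where q = m - 1 and
    w(u) = 2 q (q+1) sin^2 u / ((q+1)^2 - 4 q cos^2 u) is the Kesten-McKay weight
    in the variable 2 sqrt q cos u; so the return amplitude is
    (1/pi) \int_0^pi cos(z cos u) w(u) du with z = 2 sqrt q t.  Since w vanishes to
    second order at the endpoints, with the same leading coefficient as
    2 q (q+1) sin^2 u / (q-1)^2, integration by parts reduces this, up to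
    O(z^-2), to \int_0^pi sin(z cos u) cos u du / z, and then to the Fresnel
    integrals C, S at sqrt(2z).  Only the square of sin z C - cos z S is needed,
    and this follows from C^2 - S^2 -> 0 and 2 C S -> pi/4; these come from the
    identity (C(x) + i S(x))^2 = i (pi/4 - \int_0^1 e^{i x^2 (1+s^2)}/(1+s^2) ds). *)

Set Implicit Arguments.
Unset Strict Implicit.
Unset Printing Implicit Defensive.

(** * Primitives and approximate integration *)

Section calculus.
Variable R : realType.
Implicit Types (f g F G : R -> R) (a b x : R).

(** Each integration by parts is done by exhibiting an approximate primitive: a closed form whose
    derivative is the integrand plus an explicit small error, so that the mean value theorem does
    the rest. The passage from the operator exponential to the integral goes through power series in
    t. The values of X^k delta_e and the integrals [km_moment r k n] satisfy one recurrence in k,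
    the former by counting neighbours, the latter by the three-term relation of the spherical
    functions, and they agree at k = 0. The odd moments at the root vanish, which turns the
    exponential series into a cosine series. The exponent 7/2 has two sources of equal size: the
    amplitude is a term of order z^(-3/2) plus O(z^-2), whose cross product is O(z^(-7/2)); and the
    Fresnel asymptotics at sqrt(2z) have error O(z^(-1/2)), which the squared main term multiplies
    by z^-3. *)

Definition has_deriv f x l := is_derive (x : R) (1 : R) f l.

Lemma has_deriv_eq f x l l' : has_deriv f x l -> l = l' -> has_deriv f x l'.
Proof. by move=> ? <-. Qed.

Lemma has_deriv_cst (c x : R) : has_deriv (fun=> c) x 0.
Proof. exact: is_derive_cst. Qed.

Lemma has_deriv_id x : has_deriv (fun y => y) x 1.
Proof. exact: is_derive_id. Qed.

Lemma has_derivD f g x l l' : has_deriv f x l -> has_deriv g x l' ->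
  has_deriv (fun y => f y + g y) x (l + l').
Proof. by move=> ? ?; exact: is_deriveD. Qed.

Lemma has_derivN f x l : has_deriv f x l -> has_deriv (fun y => - f y) x (- l).
Proof. by move=> ?; exact: is_deriveN. Qed.

Lemma has_derivM f g x l l' : has_deriv f x l -> has_deriv g x l' ->
  has_deriv (fun y => f y * g y) x (l * g x + f x * l').
Proof.
move=> df dg; apply: has_deriv_eq (is_deriveM df dg) _.
by rewrite /GRing.scale /= addrC mulrC.
Qed.

Lemma has_derivX f n x l : has_deriv f x l ->
  has_deriv (fun y => f y ^+ n) x (n%:R * f x ^+ n.-1 * l).
Proof.
move=> df; elim: n => [|n IHn].
  by rewrite !mul0r; exact: has_deriv_cst.
under eq_fun do rewrite exprS.
apply: has_deriv_eq (has_derivM df IHn) _.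
case: n {IHn} => [|n] /=; first by rewrite expr0; ring.
by rewrite exprS -[n.+2]addn1 natrD; ring.
Qed.

Lemma has_derivV f x l : f x != 0 -> has_deriv f x l ->
  has_deriv (fun y => (f y)^-1) x (- (f x) ^- 2 * l).
Proof. by move=> f0 df; exact: is_deriveV. Qed.

Lemma has_deriv_comp f g x l l' : has_deriv g x l -> has_deriv f (g x) l' ->
  has_deriv (fun y => f (g y)) x (l' * l).
Proof. by move=> dg df; exact: is_derive1_comp. Qed.

Lemma has_deriv_cos f x l : has_deriv f x l ->
  has_deriv (fun y => cos (f y)) x (- sin (f x) * l).
Proof. by move=> df; apply: has_deriv_comp => //; exact: is_derive_cos. Qed.

Lemma has_deriv_sin f x l : has_deriv f x l ->
  has_deriv (fun y => sin (f y)) x (cos (f x) * l).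
Proof. by move=> df; apply: has_deriv_comp => //; exact: is_derive_sin. Qed.

Lemma has_deriv_continuous f x l : has_deriv f x l -> {for x, continuous f}.
Proof.
by case=> df _; apply/differentiable_continuous/derivable1_diffP.
Qed.

Lemma deriv_continuous f : (forall x, exists l, has_deriv f x l) -> continuous f.
Proof. by move=> df x; have [l] := df x; exact: has_deriv_continuous. Qed.

Lemma mean_value_le f df a b M : a <= b ->
  (forall x, a <= x <= b -> has_deriv f x (df x)) ->
  (forall x, a <= x <= b -> `|df x| <= M) ->
  `|f b - f a| <= M * (b - a).
Proof.
move=> ab dfE dfM.
have [||c] := @MVT_segment R f df a b ab.
- move=> x; rewrite in_itv /= => /andP[/ltW ax /ltW xb].
  by apply: dfE; rewrite ax.
- apply: continuous_in_subspaceT => x.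
  rewrite inE /= in_itv /= => xab.
  exact: has_deriv_continuous (dfE _ xab).
rewrite in_itv /= => cab ->; rewrite normrM (ger0_norm (x := b - a)) ?subr_ge0//.
by rewrite ler_wpM2r ?subr_ge0// dfM.
Qed.

(* The base point -1 makes prim f an honest primitive on a neighbourhood of
   [0, +oo[, which is all that is integrated over below. *)
Definition prim f : R -> R :=
  fun x => (\int[@lebesgue_measure R]_(t in `[(-1 : R), x]) f t)%R.

Lemma prim_deriv f x : continuous f -> -1 < x -> has_deriv (prim f) x (f x).
Proof.
move=> cf x0.
have xu : x < x + 1 by rewrite ltrDl.
have fi : (@lebesgue_measure R).-integrable `[-1, x + 1] (EFin \o f).
  apply: continuous_compact_integrable; first exact: segment_compact.
  exact: continuous_subspaceT.
have [] := @continuous_FTC1_closed R f (-1) x (x + 1) xu fi x0 (cf x).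
rewrite -/(prim f) derive1E => d1 d2.
by rewrite /has_deriv -d2; exact: DeriveDef.
Qed.

Definition Int f a b := prim f b - prim f a.

(** This plays the part of integration by parts: [G] collects the boundary terms, and [f - g] is the
    integrand of the remaining integral, estimated by its supremum. *)
Lemma Int_approx f G g a b M : continuous f -> 0 <= a -> a <= b ->
  (forall x, a <= x <= b -> has_deriv G x (g x)) ->
  (forall x, a <= x <= b -> `|f x - g x| <= M) ->
  `|Int f a b - (G b - G a)| <= M * (b - a).
Proof.
move=> cf a0 ab dG fg.
have -> : Int f a b - (G b - G a) = (prim f b + - G b) - (prim f a + - G a).
  by rewrite /Int; ring.
apply: (@mean_value_le (fun y => prim f y + - G y) (fun x => f x - g x)) => //.
move=> x /[dup] xab /andP[ax _]; apply: has_derivD; last exact/has_derivN/dG.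
by apply: prim_deriv => //; rewrite (lt_le_trans _ (le_trans a0 ax)) // ltrN10.
Qed.

Lemma Int_eq f G a b : continuous f -> 0 <= a -> a <= b ->
  (forall x, a <= x <= b -> has_deriv G x (f x)) -> Int f a b = G b - G a.
Proof.
move=> cf a0 ab dG; apply/eqP; rewrite -subr_eq0 -normr_le0 -(mul0r (b - a)).
by apply: (@Int_approx f G f) => // x _; rewrite subrr normr0.
Qed.

Lemma Int_le f a b M : continuous f -> 0 <= a -> a <= b ->
  (forall x, a <= x <= b -> `|f x| <= M) -> `|Int f a b| <= M * (b - a).
Proof.
move=> cf a0 ab fM.
rewrite -[Int f a b]subr0 -(subrr (0 : R)).
apply: (@Int_approx f (fun=> 0) (fun=> 0)) => // x xab.
  exact: has_deriv_cst.
by rewrite subr0 fM.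
Qed.

Lemma Int_lin f g (k l : R) a b : continuous f -> continuous g ->
  0 <= a -> a <= b ->
  Int (fun x => k * f x + l * g x) a b = k * Int f a b + l * Int g a b.
Proof.
move=> cf cg a0 ab.
have pos x : a <= x -> -1 < x.
  by move=> ax; rewrite (lt_le_trans _ (le_trans a0 ax)) // ltrN10.
rewrite (@Int_eq _ (fun x => k * prim f x + l * prim g x)) //.
- by rewrite /Int; ring.
- move=> x; apply: cvgD; first exact: (cvgM (cvg_cst k) (cf x)).
  exact: (cvgM (cvg_cst l) (cg x)).
move=> x /andP[ax _]; apply: has_derivD.
  apply: has_deriv_eq (has_derivM (has_deriv_cst _ _) (prim_deriv cf (pos _ ax))) _.
  by rewrite mul0r add0r.
apply: has_deriv_eq (has_derivM (has_deriv_cst _ _) (prim_deriv cg (pos _ ax))) _.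
by rewrite mul0r add0r.
Qed.

Lemma Int_scale f (k : R) a b : continuous f -> 0 <= a -> a <= b ->
  Int (fun x => k * f x) a b = k * Int f a b.
Proof.
move=> cf a0 ab; have := Int_lin k 0 cf cf a0 ab.
by rewrite mul0r addr0 => <-; congr Int; apply/funext => x; rewrite mul0r addr0.
Qed.

End calculus.

Ltac derive_rec :=
  lazymatch goal with
  | |- has_deriv (fun=> ?c) _ _ => apply: has_deriv_cst
  | |- has_deriv (fun y => y) _ _ => apply: has_deriv_id
  | |- has_deriv (fun y => @?f y + @?g y) _ _ =>
      apply: (@has_derivD _ f g); derive_rec
  | |- has_deriv (fun y => - @?f y) _ _ => apply: (@has_derivN _ f); derive_rec
  | |- has_deriv (fun y => @?f y * @?g y) _ _ =>
      apply: (@has_derivM _ f g); derive_rec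
  | |- has_deriv (fun y => @?f y ^+ ?n) _ _ =>
      apply: (@has_derivX _ f n); derive_rec
  | |- has_deriv (fun y => (@?f y)^-1) _ _ =>
      apply: (@has_derivV _ f); [|derive_rec]
  | |- has_deriv (fun y => cos (@?f y)) _ _ =>
      apply: (@has_deriv_cos _ f); derive_rec
  | |- has_deriv (fun y => sin (@?f y)) _ _ =>
      apply: (@has_deriv_sin _ f); derive_rec
  | _ => idtac
  end.
Ltac derive_tac := apply: has_deriv_eq; [derive_rec|rewrite /=].

Ltac continuous_tac :=
  apply: deriv_continuous => ?; eexists; derive_rec.

(** * Fresnel integrals *)

Section fresnel.
Variable R : realType.
Implicit Types (f g F G : R -> R) (a b x s z u p T : R).

(** Serves to differentiate under the integral sign: a quadratic error that is uniform in the
    integration variable stays quadratic after integration. *)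
Lemma has_deriv_quadratic f x l K : 
  (forall h, `|f (x + h) - f x - h * l| <= K * h ^+ 2) -> has_deriv f x l.
Proof.
move=> fK.
have cv : h^-1 *: ((f \o shift x) (h *: 1) - f x) @[h --> 0^'] --> l.
  have K0 : 0 <= K.
    by have := le_trans (normr_ge0 _) (fK 1); rewrite expr1n mulr1.
  apply/cvgrPdist_le => e e0; near=> h => /=.
  have h0 : h != 0 by near: h; exact: nbhs_dnbhs_neq.
  have -> : l - h^-1 *: (f (h *: 1 + x) - f x) =
      - (h^-1 * (f (x + h) - f x - h * l)).
    by rewrite /GRing.scale /= mulr1 [h + x]addrC; field.
  rewrite normrN normrM normfV ler_pdivrMl ?normr_gt0//.
  apply: (le_trans (fK h)); rewrite -[h ^+ 2]real_normK ?num_real// expr2.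
  rewrite mulrCA; rewrite ler_wpM2l//.
  have he : `|h| <= e / (K + 1).
    near: h; apply: dnbhs0_le; rewrite divr_gt0//; lra.
  rewrite (le_trans (ler_wpM2l K0 he))//.
  rewrite mulrA ler_pdivrMr; last lra.
  by rewrite mulrDr mulr1 mulrC lerDl ltW.
apply: DeriveDef; first by apply/cvg_ex; exists l.
exact/cvg_lim.
Unshelve. all: by end_near. Qed.

Lemma mean_value_norm f df u M : 
  (forall x, `|x| <= `|u| -> has_deriv f x (df x)) ->
  (forall x, `|x| <= `|u| -> `|df x| <= M) ->
  `|f u - f 0| <= M * `|u|.
Proof.
move=> dfE dfM; have [u0|u0] := leP 0 u.
  have := @mean_value_le R f df 0 u M u0; rewrite subr0 (ger0_norm u0); apply.
    by move=> x /andP[x0 xu]; apply: dfE; rewrite !ger0_norm.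
  by move=> x /andP[x0 xu]; apply: dfM; rewrite !ger0_norm.
have := @mean_value_le R f df u 0 M (ltW u0).
rewrite sub0r (ltr0_norm u0) distrC; apply.
  by move=> x /andP[x0 xu]; apply: dfE; rewrite (ltr0_norm u0) ler0_norm ?lerN2.
by move=> x /andP[x0 xu]; apply: dfM; rewrite (ltr0_norm u0) ler0_norm ?lerN2.
Qed.

Lemma cos_norm_le1 x : `|cos x| <= 1.
Proof. by rewrite ler_norml cos_geN1 cos_le1. Qed.

Lemma sin_norm_le1 x : `|sin x| <= 1.
Proof. by rewrite ler_norml sin_geN1 sin_le1. Qed.

Lemma sin_quadratic a u : `|sin (a + u) - sin a - u * cos a| <= u ^+ 2.
Proof.
have dcos v : `|cos (a + v) - cos a| <= `|v|.
  have := @mean_value_norm (fun y => cos (a + y)) (fun y => - sin (a + y)) v 1.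
  rewrite addr0 mul1r; apply => y _; first by derive_tac; ring.
  by rewrite normrN sin_norm_le1.
have := @mean_value_norm (fun y => sin (a + y) - y * cos a)
  (fun y => cos (a + y) - cos a) u `|u|.
rewrite addr0 mul0r subr0 -expr2 real_normK ?num_real// addrAC; apply => y yu.
  by derive_tac; ring.
exact: le_trans yu.
Qed.

Definition fresC x := Int (fun y : R => cos (y ^+ 2)) 0 x.
Definition fresS x := Int (fun y : R => sin (y ^+ 2)) 0 x.

Lemma fresC0 : fresC 0 = 0. Proof. by rewrite /fresC /Int subrr. Qed.
Lemma fresS0 : fresS 0 = 0. Proof. by rewrite /fresS /Int subrr. Qed.

Lemma fresC_deriv x : -1 < x -> has_deriv fresC x (cos (x ^+ 2)).
Proof.
move=> x1; have cc : continuous (fun y : R => cos (y ^+ 2)) by continuous_tac.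
rewrite /fresC /Int; apply: has_deriv_eq (addr0 _).
by apply: has_derivD; [exact: prim_deriv|exact: has_deriv_cst].
Qed.

Lemma fresS_deriv x : -1 < x -> has_deriv fresS x (sin (x ^+ 2)).
Proof.
move=> x1; have cc : continuous (fun y : R => sin (y ^+ 2)) by continuous_tac.
rewrite /fresS /Int; apply: has_deriv_eq (addr0 _).
by apply: has_derivD; [exact: prim_deriv|exact: has_deriv_cst].
Qed.

(* Real form of the auxiliary function \int_0^1 e^{iT(1+s^2)}/(1+s^2) ds, whose
   T-derivative at T = x^2 is a multiple of that of (fresC x + i fresS x)^2. *)
Definition fresG p T :=
  Int (fun s : R => sin (p + T * (1 + s ^+ 2)) * (1 + s ^+ 2)^-1) 0 1.

Lemma one_sqr_gt0 s : 0 < 1 + s ^+ 2.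
Proof. by rewrite ltr_pwDl ?sqr_ge0. Qed.

Lemma one_sqr_neq0 s : 1 + s ^+ 2 != 0.
Proof. by rewrite gt_eqF ?one_sqr_gt0. Qed.
#[local] Hint Resolve one_sqr_neq0 one_sqr_gt0 : core.

Lemma fresG_continuous p T :
  continuous (fun s : R => sin (p + T * (1 + s ^+ 2)) * (1 + s ^+ 2)^-1).
Proof. by continuous_tac. Qed.

Lemma fresG_deriv p T : has_deriv (fresG p) T
  (Int (fun s : R => cos (p + T * (1 + s ^+ 2))) 0 1).
Proof.
(* With b = 1 + s^2 the error of the integrand is at most (h b)^2 / b = h^2 b, and b <= 2 on
   [0, 1]. *)
apply: (@has_deriv_quadratic _ _ _ 2) => h.
have cc : continuous (fun s : R => cos (p + T * (1 + s ^+ 2))).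
  by continuous_tac.
have -> : fresG p (T + h) - fresG p T -
    h * Int (fun s : R => cos (p + T * (1 + s ^+ 2))) 0 1 =
  1 * Int (fun s => 1 * (sin (p + (T + h) * (1 + s ^+ 2)) * (1 + s ^+ 2)^-1)
       + (- 1) * (sin (p + T * (1 + s ^+ 2)) * (1 + s ^+ 2)^-1)) 0 1
  + (- h) * Int (fun s : R => cos (p + T * (1 + s ^+ 2))) 0 1.
  by rewrite Int_lin ?lexx//; [rewrite /fresG; ring|exact: fresG_continuous..].
rewrite -Int_lin//; last first.
  by continuous_tac.
rewrite -[leRHS]mulr1 -[X in _ * X]subr0.
apply: Int_le => //; first by continuous_tac.
move=> s /andP[s0 s1].
set b := 1 + s ^+ 2.
have b0 : 0 < b := one_sqr_gt0 s.
have bn0 : b != 0 by rewrite gt_eqF.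
have b2 : b <= 2 by rewrite /b -[2]/(1 + 1) lerD2l expr_le1.
have -> : 1 * (1 * (sin (p + (T + h) * b) * b^-1)
     + -1 * (sin (p + T * b) * b^-1)) + - h * cos (p + T * b)
  = (sin ((p + T * b) + h * b) - sin (p + T * b) - (h * b) * cos (p + T * b)) / b.
  by rewrite (_ : p + (T + h) * b = p + T * b + h * b); [field|ring].
rewrite normrM normfV (gtr0_norm b0) ler_pdivrMr//.
apply: le_trans (sin_quadratic _ _) _.
have -> : 2 * h ^+ 2 * b = h ^+ 2 * (2 * b) by ring.
by rewrite exprMn ler_wpM2l ?sqr_ge0// expr2 ler_wpM2r// ltW.
Qed.

Lemma fresG_le1 p T : `|fresG p T| <= 1.
Proof.
rewrite -[leRHS]mulr1 -[X in _ * X]subr0; apply: Int_le => //.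
  exact: fresG_continuous.
move=> s _; rewrite normrM normfV (gtr0_norm (one_sqr_gt0 s)).
rewrite ler_pdivrMr// mul1r (le_trans (sin_norm_le1 _))//.
by rewrite lerDl sqr_ge0.
Qed.

Lemma fresG0 p : fresG p 0 = sin p * (pi / 4).
Proof.
rewrite /fresG (@Int_eq _ _ (fun s => sin p * atan s)); [| |exact: lexx|exact: ler01|].
- by rewrite atan1 atan0; ring.
- exact: fresG_continuous.
move=> s _; rewrite mul0r addr0.
apply: has_deriv_eq (has_derivM (has_deriv_cst _ _) (is_derive1_atan _)) _.
by rewrite mul0r add0r.
Qed.

(** Substitute y = x s, with Jacobian x, and expand the cosine of (p + x^2) + y^2. The primitive
    divides by x, so x = 0 is treated apart. *)
Lemma fresG_deriv_sqr p x : 0 <= x ->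
  x * Int (fun s : R => cos (p + x ^+ 2 * (1 + s ^+ 2))) 0 1 =
  cos (p + x ^+ 2) * fresC x - sin (p + x ^+ 2) * fresS x.
Proof.
rewrite le_eqVlt => /predU1P[<-|x0].
  by rewrite fresC0 fresS0 mul0r !mulr0 subrr.
have xn0 : x != 0 by rewrite gt_eqF.
rewrite (@Int_eq _ _ (fun s => x^-1 * (cos (p + x ^+ 2) * fresC (x * s)
  - sin (p + x ^+ 2) * fresS (x * s)))); [| |exact: lexx|exact: ler01|].
- by rewrite mulr1 mulr0 fresC0 fresS0; field.
- by continuous_tac.
move=> s /andP[s0 _].
have xs : -1 < x * s by rewrite (lt_le_trans (ltrN10 _))// mulr_ge0// ltW.
apply: has_deriv_eq.
  apply: has_derivM; first exact: has_deriv_cst.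
  apply: has_derivD; [|apply: has_derivN];
    (apply: has_derivM; [exact: has_deriv_cst|]).
    apply: (has_deriv_comp (g := fun s => x * s)); last exact: fresC_deriv.
    by derive_rec.
  apply: (has_deriv_comp (g := fun s => x * s)); last exact: fresS_deriv.
  by derive_rec.
have -> : p + x ^+ 2 * (1 + s ^+ 2) = (p + x ^+ 2) + (x * s) ^+ 2 by ring.
by rewrite [in RHS]cosD; field.
Qed.

(** The real part of the complex identity for (C + i S)^2 after multiplication by e^{ip}: the phase
    [p] covers real and imaginary parts at once. The two sides have equal derivatives in x and agree
    at 0. *)
Lemma fresG_sqr p x : 0 <= x -> fresG p (x ^+ 2) =
  cos p * (fresC x ^+ 2 - fresS x ^+ 2) - sin p * (2 * fresC x * fresS x)
  + sin p * (pi / 4).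
Proof.
move=> x0.
pose D y := fresG p (y ^+ 2) -
  (cos p * (fresC y ^+ 2 - fresS y ^+ 2) - sin p * (2 * fresC y * fresS y)).
suff: `|D x - D 0| <= 0 * (x - 0).
  rewrite mul0r normr_le0 subr_eq0 /D fresC0 fresS0 expr0n /= fresG0 => /eqP.
  by rewrite !mulr0 !subr0 mulr0 subr0 => <-; rewrite addrC subrK.
apply: (@mean_value_le _ _ (fun=> 0)) => // [y /andP[y0 yx]|y _]; last first.
  by rewrite normr0.
have y1 : -1 < y by rewrite (lt_le_trans (ltrN10 _)).
apply: has_deriv_eq.
  apply: has_derivD; last apply: has_derivN.
    by apply: has_deriv_comp (fresG_deriv _ _); derive_rec.
  derive_rec; solve [exact: fresC_deriv | exact: fresS_deriv].
have := fresG_deriv_sqr p y0; set I := Int _ _ _ => hI.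
rewrite /=.
have -> : I * (2%:R * y ^+ 1 * 1) = 2 * (y * I) by ring.
rewrite hI cosD sinD; ring.
Qed.

Lemma fres_sqr_diff x : 0 <= x ->
  fresC x ^+ 2 - fresS x ^+ 2 = fresG 0 (x ^+ 2).
Proof. by move=> /(fresG_sqr 0) ->; rewrite cos0 sin0; ring. Qed.

Lemma fres_mul x : 0 <= x ->
  2 * fresC x * fresS x = pi / 4 - fresG (pi / 2) (x ^+ 2).
Proof. by move=> /(fresG_sqr (pi / 2)) ->; rewrite cos_pihalf sin_pihalf; ring. Qed.

(** Boundedness comes from the squared identities alone: (C^2 + S^2)^2 = (C^2 - S^2)^2 + (2 C S)^2,
    which is at most 1 + 2^2 since [fresG] is bounded by 1 and pi / 4 <= 1. *)
Lemma fres_bounded x : 0 <= x -> `|fresC x| <= 2 /\ `|fresS x| <= 2.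
Proof.
move=> x0; have [pi0 pi4] : 0 <= pi :> R /\ pi <= 4 :> R.
  by split; [exact: pi_ge0|have := pihalf_lt2 R; lra].
have := fresG_le1 0 (x ^+ 2); have := fresG_le1 (pi / 2) (x ^+ 2).
move: (fres_sqr_diff x0) (fres_mul x0).
move: (fresG _ _) (fresG _ _) => h g; set c := fresC x; set s := fresS x.
move=> dE mE; rewrite !ler_norml => hg hh.
have sq : (c ^+ 2 + s ^+ 2) ^+ 2 <= 5.
  have -> : (c ^+ 2 + s ^+ 2) ^+ 2 = g ^+ 2 + (pi / 4 - h) ^+ 2.
    by rewrite -dE -mE; ring.
  nra.
have {}sq : c ^+ 2 + s ^+ 2 <= 4 by nra.
by split; nra.
Qed.

(** The phase is stationary at s = 0, so 1/(1 + s^2) is split as 1 - s * s/(1 + s^2). The first part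
    gives Fresnel integrals divided by x, at most 4 / x; in the second the factor s makes the
    oscillation an exact derivative, at a cost of 3/4 x^-2. *)
Lemma fresG_decay p x : 1 <= x -> `|fresG p (x ^+ 2)| <= 5 / x.
Proof.
move=> x1; have x0 : 0 < x by rewrite (lt_le_trans _ x1).
have xn0 : x != 0 by rewrite gt_eqF.
have [C2 S2] := fres_bounded (ltW x0).
set f := fun s : R => sin (p + x ^+ 2 * (1 + s ^+ 2)) * (1 + s ^+ 2)^-1.
pose G s := x^-1 * (sin (p + x ^+ 2) * fresC (x * s)
    + cos (p + x ^+ 2) * fresS (x * s))
  + (2 * x ^+ 2)^-1 * (cos (p + x ^+ 2 * (1 + s ^+ 2)) * (s * (1 + s ^+ 2)^-1)).
pose g s := f s + (2 * x ^+ 2)^-1 *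
   (cos (p + x ^+ 2 * (1 + s ^+ 2)) * ((1 - s ^+ 2) / (1 + s ^+ 2) ^+ 2)).
have := @Int_approx _ f G g 0 1 (2 * x ^+ 2)^-1 (@fresG_continuous _ _)
   (lexx _) ler01.
rewrite -/(fresG p (x ^+ 2)) subr0 mulr1.
have x2 : 0 < 2 * x ^+ 2 by rewrite mulr_gt0 ?exprn_gt0.
have xV : 0 < x^-1 by rewrite invr_gt0.
have xV1 : x^-1 <= 1 by rewrite invf_le1.
have VE : (2 * x ^+ 2)^-1 = 2^-1 * x^-1 ^+ 2 by rewrite invfM exprVn.
have -> : G 0 = 0.
  by rewrite /G mulr0 fresC0 fresS0; ring.
rewrite subr0 => bound.
suff: `|fresG p (x ^+ 2)| <= `|G 1| + (2 * x ^+ 2)^-1.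
  move=> /le_trans; apply.
  have C2' : `|sin (p + x ^+ 2) * fresC (x * 1)| <= 2.
    by rewrite mulr1 normrM -[2]mul1r ler_pM// sin_norm_le1.
  have S2' : `|cos (p + x ^+ 2) * fresS (x * 1)| <= 2.
    by rewrite mulr1 normrM -[2]mul1r ler_pM// cos_norm_le1.
  have c1 : `|cos (p + x ^+ 2 * (1 + 1 ^+ 2))| <= 1 := cos_norm_le1 _.
  rewrite /G VE; move: C2' S2' c1; rewrite !ler_norml expr1n.
  move: (_ * fresC _) (_ * fresS _) (cos (p + _ * _)) => A B c.
  rewrite -[5 / x]/(5 * x^-1); move: x^-1 xV xV1 => y y0 y1.
  move=> hA hB hc; rewrite -lerBrDr ler_norml.
  have y2 : y ^+ 2 <= y by rewrite expr2 ler_piMl // ltW.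
  have y20 : 0 <= y ^+ 2 by rewrite sqr_ge0.
  have h1 : - (4 * y) <= y * (A + B) <= 4 * y by nra.
  have h2 : - (y ^+ 2) <= y ^+ 2 * c <= y ^+ 2 by nra.
  by rewrite mul1r -[1 + 1]/(2 : R); lra.
rewrite -lerBlDl; apply: le_trans (lerB_dist _ _) _; apply: bound.
- move=> s /andP[s0 s1].
  have xs : -1 < x * s by rewrite (lt_le_trans (ltrN10 _))// mulr_ge0// ltW.
  apply: has_deriv_eq.
    apply: has_derivD; last by derive_rec.
    apply: has_derivM; first exact: has_deriv_cst.
    apply: has_derivD; (apply: has_derivM; [exact: has_deriv_cst|]).
      apply: (has_deriv_comp (g := fun s => x * s)); last exact: fresC_deriv.
      by derive_rec.
    apply: (has_deriv_comp (g := fun s => x * s)); last exact: fresS_deriv.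
    by derive_rec.
  rewrite /g /f /=.
  have -> : p + x ^+ 2 * (1 + s ^+ 2) = (p + x ^+ 2) + (x * s) ^+ 2 by ring.
  have n0 := one_sqr_neq0 s; move: (p + x ^+ 2) => q.
  by rewrite sinD cosD; field; rewrite xn0 n0.
- move=> s /andP[s0 s1]; rewrite /g opprD addrA subrr sub0r normrN normrM.
  rewrite (gtr0_norm (x := (2 * x ^+ 2)^-1)) ?invr_gt0//.
  rewrite -[leRHS]mulr1; apply: ler_wpM2l; first by rewrite invr_ge0 ltW.
  rewrite normrM -[leRHS]mulr1 ler_pM ?cos_norm_le1//.
  rewrite normrM normfV (gtr0_norm (x := _ ^+ 2)) ?exprn_gt0//.
  rewrite ler_pdivrMr ?exprn_gt0// mul1r ler_norml; nra.
Qed.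

Lemma sin_sub_piquarter_sqr z :
  sin (z - pi / 4) ^+ 2 = (sin z - cos z) ^+ 2 / 2.
Proof.
have : tan (pi / 4) = 1 :> R by exact: tan_piquarter.
have : cos (pi / 4) ^+ 2 + sin (pi / 4) ^+ 2 = 1 :> R by exact: cos2Dsin2.
rewrite sinB /tan; move: (cos (pi / 4)) (sin (pi / 4)) => a b ab.
have [->|a0] := eqVneq a 0; first by rewrite invr0 mulr0 => /eqP; rewrite lt_eqF.
move=> /divr1_eq ba; move: ab; rewrite ba => a2.
have -> : 2^-1 = a ^+ 2 by lra.
by ring.
Qed.

(** The square expands into C^2 + S^2, C^2 - S^2 and 2 C S. The decay of [fresG] controls the last
    two directly, and the first through the sum of their squares. *)
Lemma fresnel_asymptotics x z : 1 <= x ->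
  `|(sin z * fresC x - cos z * fresS x) ^+ 2 - pi / 4 * sin (z - pi / 4) ^+ 2|
  <= 100 / x.
Proof.
move=> x1; have x0 : 0 < x by rewrite (lt_le_trans _ x1).
have hd := fres_sqr_diff (ltW x0); have hm := fres_mul (ltW x0).
have := fresG_decay 0 x1; have := fresG_decay (pi / 2) x1.
have := fresG_le1 0 (x ^+ 2); have := fresG_le1 (pi / 2) (x ^+ 2).
move: hd hm; move: (fresG _ _) (fresG _ _) => h g.
set C := fresC x; set S := fresS x => gE hE.
have pi2 : 2 <= pi :> R := pi_ge2 _.
have pi4 : pi <= 4 :> R by have := pihalf_lt2 R; lra.
rewrite sin_sub_piquarter_sqr.
rewrite -[100 / x]/(100 * x^-1) -[5 / x]/(5 * x^-1).
have : 0 < x^-1 by rewrite invr_gt0.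
move: x^-1 => y y0 h1 g1 hy gy.
have sqE : (C ^+ 2 + S ^+ 2) ^+ 2 - (pi / 4) ^+ 2 = g ^+ 2 - h * (pi / 2 - h).
  rewrite -gE; have -> : h = pi / 4 - 2 * C * S by rewrite hE; ring.
  by field.
set r := C ^+ 2 + S ^+ 2 in sqE.
have r0 : 0 <= r by rewrite addr_ge0 ?sqr_ge0.
(* Factor r^2 - (pi/4)^2, which is at most 20 y in absolute value, and divide by r + pi/4 >= 1/2. *)
have rpi : `|r - pi / 4| <= 40 * y.
  have : `|(r - pi / 4) * (r + pi / 4)| <= 5 * y * 1 + 5 * y * 3.
    have -> : (r - pi / 4) * (r + pi / 4) = g * g - h * (pi / 2 - h).
      by rewrite -expr2 -sqE; ring.
    rewrite (le_trans (ler_normB _ _))// !normrM lerD// ler_pM//.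
    by move: h1; rewrite !ler_norml; lra.
  rewrite normrM (ger0_norm (x := r + pi / 4)); last lra.
  move: `|r - pi / 4| (normr_ge0 (r - pi / 4)) => w w0; nra.
have -> : (sin z * C - cos z * S) ^+ 2 - pi / 4 * ((sin z - cos z) ^+ 2 / 2)
  = (sin z ^+ 2 + cos z ^+ 2) * (r - pi / 4) / 2
   + (sin z ^+ 2 - cos z ^+ 2) * g / 2 + sin z * cos z * h.
  rewrite -gE; have -> : h = pi / 4 - 2 * C * S by rewrite hE; ring.
  by rewrite /r; field.
have := cos2Dsin2 z; rewrite addrC => uv1; rewrite uv1.
have := sin_norm_le1 z; have := cos_norm_le1 z.
move: (sin z) (cos z) uv1 => u v uv1 hv hu.
have : `|(u ^+ 2 - v ^+ 2) * g| <= 1 * (5 * y).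
  rewrite normrM ler_pM// ler_norml; nra.
have : `|u * v * h| <= 1 * (5 * y).
  by rewrite normrM ler_pM// normrM -[leRHS]mulr1 ler_pM.
by move: rpi; rewrite !ler_norml; lra.
Qed.

End fresnel.

(** * The Kesten-McKay transform for large argument *)

Section bessel.
Variable R : realType.
Implicit Types (f g F G : R -> R) (a b x y z t q : R).

Lemma continuous_bounded f a b : continuous f -> a <= b ->
  exists2 M : R, 0 <= M & forall x, a <= x <= b -> `|f x| <= M.
Proof.
move=> cf ab; have cg : {within `[a, b], continuous (fun x => `|f x|)}.
  apply: continuous_subspaceT => x.
  exact: (continuous_comp (cf x) (@norm_continuous _ _ _)).
have [c _ hc] := EVT_max ab cg.
by exists `|f c| => // x xab; apply: hc; rewrite in_itv.
Qed.

(** The integral of sin(z - u^2) over [0, y]. Since z cos t = z - 2 z sin^2(t/2), the substitution u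
    = sqrt(2z) sin(t/2) leads to the argument sqrt(2z). *)
Definition fresF z y := sin z * fresC y - cos z * fresS y.

Lemma fresF0 z : fresF z 0 = 0.
Proof. by rewrite /fresF fresC0 fresS0; ring. Qed.

Lemma fresF_deriv z y : -1 < y -> has_deriv (fresF z) y (sin (z - y ^+ 2)).
Proof.
move=> y1; apply: has_deriv_eq.
  apply: has_derivD; last apply: has_derivN;
    (apply: has_derivM; [exact: has_deriv_cst|]).
    exact: fresC_deriv.
  exact: fresS_deriv.
by rewrite sinB; ring.
Qed.

Lemma halfD t : t = t / 2 + t / 2.
Proof. by field. Qed.

(* cos t = (c - s) + sin t * k with c = cos (t/2), s = sin (t/2): the first part
   integrates exactly to Fresnel integrals, and the second is smaller by 1/z
   after one integration by parts. *)
Lemma int_sin_cos_approx : exists2 K : R, 0 <= K & forall z, 0 < z ->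
  `|Int (fun t => sin (z * cos t) * cos t) 0 pi
    - 4 / Num.sqrt (2 * z) * fresF z (Num.sqrt (2 * z))| <= K / z.
Proof.
exists (1 + 5 * pi) => [|z z0]; first by have := pi_ge0 R; lra.
have zn0 : z != 0 by rewrite gt_eqF.
have X0 : 0 < Num.sqrt (2 * z) by rewrite sqrtr_gt0 mulr_gt0.
have X2 : Num.sqrt (2 * z) ^+ 2 = 2 * z by rewrite sqr_sqrtr// mulr_ge0// ltW.
move: (Num.sqrt _) X0 X2 => X X0 X2.
have Xn0 : X != 0 by rewrite gt_eqF.
(* The quotient (cos t - (c - s)) / sin t after cancelling c + s - 1; the remaining denominator is
   positive on [0, pi], where sin t vanishes at both ends. *)
pose k t : R := (cos (t / 2) - sin (t / 2)) * (cos (t / 2) + sin (t / 2) + 1)^-1.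
pose dk t : R := (- (cos (t / 2) + sin (t / 2)) * (cos (t / 2) + sin (t / 2) + 1)
   - (cos (t / 2) - sin (t / 2)) ^+ 2) / 2
  / (cos (t / 2) + sin (t / 2) + 1) ^+ 2.
(* Both endpoints are stationary. The phases z - (X sin(t/2))^2 and z - (X cos(t/2))^2 are z cos t
   and - z cos t, so the two Fresnel terms contribute sin(z cos t) times c and - s respectively. *)
pose G t := 2 / X * (fresF z (X * sin (t / 2)) - fresF z (X * cos (t / 2)))
  + z^-1 * (cos (z * cos t) * k t).
pose g t := sin (z * cos t) * cos t + z^-1 * (cos (z * cos t) * dk t).
have GE : G pi - G 0 = 4 / X * fresF z X - cos z / z.
  rewrite /G /k mul0r cospi cos0 sin0 cos_pihalf sin_pihalf !mulr0 !mulr1.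
  by rewrite fresF0 mulrN1 cosN; field; rewrite zn0 Xn0.
have cs_ge0 t : 0 <= t <= pi -> 0 <= cos (t / 2) /\ 0 <= sin (t / 2).
  by move=> tpi; split; [apply: cos_ge0_pihalf|apply: sin_ge0_pi]; lra.
have := @Int_approx _ (fun t => sin (z * cos t) * cos t) G g 0 pi (5 / z).
rewrite GE subr0 => /(_ _ (lexx _) (pi_ge0 R)) => bound.
have {}bound : `|Int (fun t => sin (z * cos t) * cos t) 0 pi
   - (4 / X * fresF z X - cos z / z)| <= 5 / z * pi.
  apply: bound.
  - by continuous_tac.
  - move=> t /cs_ge0[c0 s0].
    have n0 : cos (t / 2) + sin (t / 2) + 1 != 0 by rewrite gt_eqF//; lra.
    have m1 : -1 < X * sin (t / 2).
      by rewrite (lt_le_trans (ltrN10 _))// mulr_ge0// ltW.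
    have m2 : -1 < X * cos (t / 2).
      by rewrite (lt_le_trans (ltrN10 _))// mulr_ge0// ltW.
    rewrite /G /k; apply: has_deriv_eq.
      apply: has_derivD; last by derive_rec.
      apply: has_derivM; first exact: has_deriv_cst.
      apply: has_derivD; last apply: has_derivN.
        apply: (has_deriv_comp (g := fun t => X * sin (t / 2))).
          by derive_rec.
        exact: fresF_deriv.
      apply: (has_deriv_comp (g := fun t => X * cos (t / 2))).
        by derive_rec.
      exact: fresF_deriv.
    have cs1 := cos2Dsin2 (t / 2).
    have ct : cos t = cos (t / 2) ^+ 2 - sin (t / 2) ^+ 2.
      by rewrite {1}(halfD t) cosD.
    have st : sin t = (cos (t / 2) + sin (t / 2) - 1)
                       * (cos (t / 2) + sin (t / 2) + 1).
      rewrite {1}(halfD t) sinD; move: cs1; move: (cos _) (sin _) => c s h.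
      have -> : (c + s - 1) * (c + s + 1) = (c ^+ 2 + s ^+ 2) + 2 * c * s - 1.
        by ring.
      by rewrite h; ring.
    have e1 : z - (X * sin (t / 2)) ^+ 2 = z * cos t.
      rewrite ct exprMn X2; move: cs1; move: (cos _) (sin _) => c s h.
      by have -> : c ^+ 2 = 1 - s ^+ 2 by [rewrite -h; ring]; ring.
    have e2 : z - (X * cos (t / 2)) ^+ 2 = - (z * cos t).
      rewrite ct exprMn X2; move: cs1; move: (cos _) (sin _) => c s h.
      by have -> : c ^+ 2 = 1 - s ^+ 2 by [rewrite -h; ring]; ring.
    rewrite /g /dk /k /= e1 e2 sinN.
    move: (cos (z * cos t)) (sin (z * cos t)) => A B; rewrite ct st.
    move: (cos (t / 2)) (sin (t / 2)) n0 => c s n0.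
    by field; rewrite zn0 Xn0 n0.
  - move=> t /cs_ge0[c0 s0].
    rewrite /g opprD addrA subrr sub0r normrN normrM gtr0_norm ?invr_gt0//.
    rewrite [leRHS]mulrC; apply: ler_wpM2l; first by rewrite invr_ge0 ltW.
    rewrite normrM -[leRHS]mul1r ler_pM//.
      exact: cos_norm_le1.
    have := cos2Dsin2 (t / 2); rewrite /dk.
    move: (cos (t / 2)) (sin (t / 2)) c0 s0 => c s c0 s0 cs1.
    have h : 0 < (c + s + 1) ^+ 2 by rewrite exprn_gt0//; lra.
    by rewrite normrM normfV (gtr0_norm h) ler_pdivrMr// ler_norml; nra.
rewrite (_ : Int _ _ _ - _ = (Int (fun t => sin (z * cos t) * cos t) 0 pi
   - (4 / X * fresF z X - cos z / z)) - cos z / z); last by ring.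
rewrite (le_trans (ler_normB _ _))//.
have -> : (1 + 5 * pi) / z = 5 / z * pi + 1 / z by field.
by rewrite lerD// normrM normfV (gtr0_norm z0) ler_pM2r ?invr_gt0// cos_norm_le1.
Qed.

(** Both sides are pi J_1(z) / z for the Bessel function J_1; the boundary term carries sin t and
    vanishes. *)
Lemma int_cos_sin2 z : 0 < z ->
  Int (fun t => cos (z * cos t) * sin t ^+ 2) 0 pi =
  z^-1 * Int (fun t => sin (z * cos t) * cos t) 0 pi.
Proof.
move=> z0; have zn0 : z != 0 by rewrite gt_eqF.
rewrite -Int_scale; [|by continuous_tac|exact: lexx|exact: pi_ge0].
apply/eqP; rewrite -subr_eq0; apply/eqP.
have c1 : continuous (fun t : R => cos (z * cos t) * sin t ^+ 2).
  by continuous_tac.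
have c2 : continuous (fun t : R => z^-1 * (sin (z * cos t) * cos t)).
  by continuous_tac.
have := Int_lin 1 (-1) c1 c2 (lexx _) (pi_ge0 R); rewrite mul1r mulN1r => <-.
rewrite (@Int_eq _ _ (fun t => - z^-1 * (sin (z * cos t) * sin t)));
  [| |exact: lexx|exact: pi_ge0|].
- by rewrite sinpi sin0; ring.
- by continuous_tac.
by move=> t _; derive_tac; field.
Qed.

(** This is |q - e^{2it}|^2 = (q - 1)^2 + 4 q sin^2 t, hence at least (q - 1)^2 for q > 1. *)
Definition km_den q t : R := (q + 1) ^+ 2 - 4 * q * cos t ^+ 2.

Lemma km_den_gt0 q t : 1 < q -> 0 < km_den q t.
Proof.
move=> q1; rewrite /km_den; have := sqr_ge0 (sin t).
have := cos2Dsin2 t; move: (cos t ^+ 2) (sin t ^+ 2) => u v uv v0.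
have -> : u = 1 - v by lra.
nra.
Qed.

(* The factor sin t ^+ 4 makes the boundary terms of two successive integrations
   by parts vanish. *)
Lemma int_cos_sin4_le q : 1 < q -> exists2 K : R, 0 <= K & forall z, 0 < z ->
  `|Int (fun t => cos (z * cos t) * (sin t ^+ 4 / km_den q t)) 0 pi| <= K / z ^+ 2.
Proof.
move=> q1; have dn0 t : km_den q t != 0 by rewrite gt_eqF ?km_den_gt0.
rewrite /km_den in dn0 *.
pose D t : R := (q + 1) ^+ 2 - 4 * q * cos t ^+ 2.
(* [w] is the derivative of [sin t ^+ 3 / D t] divided by [sin t], ready for the second integration
   by parts, and [dw] is the derivative of [w]. *)
pose w t := 3 * sin t * cos t / D t - 8 * q * (sin t ^+ 3 * cos t) / D t ^+ 2.
pose dw t := 3 * (cos t ^+ 2 - sin t ^+ 2) / D t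
  - 24 * q * (sin t * cos t) ^+ 2 / D t ^+ 2
  - 8 * q * (3 * (sin t * cos t) ^+ 2 - sin t ^+ 4) / D t ^+ 2
  + 128 * q ^+ 2 * sin t ^+ 4 * cos t ^+ 2 / D t ^+ 3.
have cdw : continuous dw.
  by rewrite /dw /D; continuous_tac; rewrite ?expf_neq0.
have [M M0 hM] := continuous_bounded cdw (pi_ge0 R).
exists (M * pi) => [|z z0]; first by rewrite mulr_ge0 ?pi_ge0.
have zn0 : z != 0 by rewrite gt_eqF.
pose G t := - z^-1 * (sin (z * cos t) * (sin t ^+ 3 / D t))
  + z^-1 ^+ 2 * (cos (z * cos t) * w t).
pose g t := cos (z * cos t) * (sin t ^+ 4 / D t)
   + z^-1 ^+ 2 * (cos (z * cos t) * dw t).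
have := @Int_approx _ (fun t => cos (z * cos t) * (sin t ^+ 4 / D t))
  G g 0 pi (M / z ^+ 2).
have -> : G pi - G 0 = 0 by rewrite /G /w sinpi sin0; ring.
rewrite !subr0 mulrAC; apply; [|exact: lexx|exact: pi_ge0|..].
- by rewrite /D; continuous_tac.
- move=> t _; have Dn0 := dn0 t; rewrite /G /w /D.
  derive_tac => //; rewrite ?expf_neq0//.
  rewrite /g /dw /D.
  move: Dn0; rewrite /D; move: (cos t) (sin t) (cos _) (sin _) => a b c d Dn0.
  by field; rewrite zn0 andbT.
- move=> t /hM dM; rewrite /g opprD addrA subrr sub0r normrN normrM.
  rewrite ger0_norm ?sqr_ge0// exprVn mulrC ler_pM2r ?invr_gt0 ?exprn_gt0//.
  by rewrite normrM -[leRHS]mul1r ler_pM// cos_norm_le1.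
Qed.

Definition km_weight q t : R := 2 * q * (q + 1) * sin t ^+ 2 / km_den q t.

(** Since km_den = (q - 1)^2 + 4 q sin^2, the weight is exactly A sin^2 - 4 q A sin^4 / km_den: the
    first term gives the Bessel integral and the second is O(z^-2). *)
Lemma km_transform_approx q : 1 < q -> exists2 K : R, 0 <= K & forall z, 0 < z ->
  `|Int (fun t => cos (z * cos t) * km_weight q t) 0 pi
    - 2 * q * (q + 1) / (q - 1) ^+ 2 / z
      * (4 / Num.sqrt (2 * z) * fresF z (Num.sqrt (2 * z)))| <= K / z ^+ 2.
Proof.
move=> q1; have q10 : q - 1 != 0 by rewrite subr_eq0 gt_eqF.
have [K1 K10 hK1] := int_sin_cos_approx.
have [K2 K20 hK2] := int_cos_sin4_le q1.
set A := 2 * q * (q + 1) / (q - 1) ^+ 2.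
have A0 : 0 <= A by rewrite divr_ge0 ?sqr_ge0//; nra.
have Aq : 0 <= A * (4 * q) by apply: (mulr_ge0 A0); lra.
exists (A * K1 + A * (4 * q) * K2) => [|z z0].
  by rewrite addr_ge0// mulr_ge0.
have zn0 : z != 0 by rewrite gt_eqF.
have := hK1 z z0; have := hK2 z z0; move: (4 / _ * _) => F.
have dn0 t : km_den q t != 0 by rewrite gt_eqF ?km_den_gt0.
have -> : (fun t => cos (z * cos t) * km_weight q t) = (fun t =>
    A * (cos (z * cos t) * sin t ^+ 2)
    + (- (A * (4 * q))) * (cos (z * cos t) * (sin t ^+ 4 / km_den q t))).
  apply/funext => t; rewrite /A /km_weight.
  have -> : cos (z * cos t) * (2 * q * (q + 1) * sin t ^+ 2 / km_den q t) =
     cos (z * cos t) * (2 * q * (q + 1) * sin t ^+ 2) / (q - 1) ^+ 2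
     * (((q - 1) ^+ 2 + 4 * q * sin t ^+ 2 - 4 * q * sin t ^+ 2) / km_den q t).
    by field; rewrite q10 dn0.
  have {1}-> : (q - 1) ^+ 2 + 4 * q * sin t ^+ 2 = km_den q t.
    by rewrite /km_den -[cos t ^+ 2](addrK (sin t ^+ 2)) cos2Dsin2; ring.
  by field; rewrite q10 dn0.
rewrite /km_den in dn0 *.
rewrite Int_lin; [|by continuous_tac|by continuous_tac; exact: dn0
  |exact: lexx|exact: pi_ge0].
rewrite int_cos_sin2//.
set J := Int _ _ _ => hJ; set I := Int _ _ _ => hI.
have -> : A * (z^-1 * I) + - (A * (4 * q)) * J - A / z * F =
  A / z * (I - F) - A * (4 * q) * J by ring.
rewrite (le_trans (ler_normB _ _))//.
have -> : (A * K1 + A * (4 * q) * K2) / z ^+ 2 =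
  A / z * (K1 / z) + A * (4 * q) * (K2 / z ^+ 2) by field.
have Az : 0 <= A / z by rewrite divr_ge0// ltW.
by rewrite lerD// normrM ger0_norm// ler_wpM2l.
Qed.

Lemma km_transform_sqr q : 1 < q -> exists2 K : R, 0 <= K & forall z, 1 <= z ->
  `|(pi^-1 * Int (fun t => cos (z * cos t) * km_weight q t) 0 pi) ^+ 2
    - 2 * (2 * q * (q + 1) / (q - 1) ^+ 2) ^+ 2 / (pi * z ^+ 3)
      * sin (z - pi / 4) ^+ 2| <= K / (z ^+ 3 * Num.sqrt (2 * z)).
Proof.
move=> q1; have [K K0 hK] := km_transform_approx q1.
set A := 2 * q * (q + 1) / (q - 1) ^+ 2 in hK *.
have A0 : 0 <= A by rewrite divr_ge0 ?sqr_ge0//; nra.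
clearbody A; have pi0 : 0 < pi :> R := pi_gt0 R.
have pin0 : pi != 0 :> R by rewrite gt_eqF.
pose B := A / pi; pose L := K / pi.
have B0 : 0 <= B by rewrite divr_ge0// ltW.
have L0 : 0 <= L by rewrite divr_ge0// ltW.
(* With amplitude u + v, the bound |F| <= 4 gives |2 u| <= 32 B y x, and y = 2 x^2 <= 2 x gives |v|
   <= 2 L y x; 800 is 8 times the Fresnel constant 100. *)
exists (L * (32 * B + 2 * L) + 800 * B ^+ 2) => [|z z1].
  by apply: addr_ge0; [apply: mulr_ge0 => //|have := sqr_ge0 B]; lra.
have z0 : 0 < z by rewrite (lt_le_trans _ z1).
have zn0 : z != 0 by rewrite gt_eqF.
have := hK z z0.
have : 1 <= Num.sqrt (2 * z).
  by rewrite -[leLHS]sqrtr1 ler_sqrt ?mulr_gt0//; lra.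
have : Num.sqrt (2 * z) ^+ 2 = 2 * z by rewrite sqr_sqrtr// mulr_ge0// ltW.
move: (Num.sqrt _) => X X2 X1.
have X0 : 0 < X by rewrite (lt_le_trans _ X1).
have Xn0 : X != 0 by rewrite gt_eqF.
have := fresnel_asymptotics z X1; rewrite -/(fresF z X).
have : `|fresF z X| <= 4.
  have [C2 S2] := fres_bounded (ltW X0).
  rewrite (le_trans (ler_normB _ _))// !normrM.
  have -> : 4 = 1 * 2 + 1 * 2 :> R by ring.
  by rewrite lerD// ler_pM// ?sin_norm_le1 ?cos_norm_le1.
move: (fresF _ _) (Int _ _ _) (sin _ ^+ 2) => F I s F4 hs hI.
move: pi pi0 pin0 @B @L B0 L0 hs => p p0 pn0 B L B0 L0 hs.
pose y := z^-1; pose x := X^-1.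
have y0 : 0 < y by rewrite invr_gt0.
have x0 : 0 < x by rewrite invr_gt0.
have x1 : x <= 1 by rewrite invf_le1.
have yx : y = 2 * x ^+ 2 by rewrite /y /x exprVn X2; field.
have -> : (L * (32 * B + 2 * L) + 800 * B ^+ 2) / (z ^+ 3 * X) =
  L * y ^+ 2 * (32 * B * (y * x) + L * (y * (2 * x)))
  + 8 * B ^+ 2 * y ^+ 3 * (100 * x).
  by rewrite /y /x; field; rewrite zn0 Xn0.
have {}hI : `|p^-1 * I - 4 * B * (y * x) * F| <= L * y ^+ 2.
  have -> : p^-1 * I - 4 * B * (y * x) * F = p^-1 * (I - A / z * (4 / X * F)).
    by rewrite /B /y /x; field; rewrite Xn0 zn0 pn0.
  have -> : L * y ^+ 2 = p^-1 * (K / z ^+ 2).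
    by rewrite /L /y; field; rewrite zn0 pn0.
  rewrite normrM gtr0_norm ?invr_gt0//; apply: ler_wpM2l => //.
  by rewrite invr_ge0 ltW.
set v := p^-1 * I - _ in hI; set u := 4 * B * (y * x) * F in v hI.
have -> : p^-1 * I = u + v by rewrite /v; ring.
have -> : (u + v) ^+ 2 - 2 * A ^+ 2 / (p * z ^+ 3) * s =
   v * (2 * u + v) + 8 * B ^+ 2 * y ^+ 3 * (F ^+ 2 - p / 4 * s).
  have -> : (u + v) ^+ 2 = v * (2 * u + v) + 16 * B ^+ 2 * y ^+ 2 * x ^+ 2 * F ^+ 2.
    by rewrite /u; ring.
  have -> : x ^+ 2 = y / 2 by rewrite yx; field.
  by rewrite /B /y; field; rewrite zn0 pn0.
rewrite (le_trans (ler_normD _ _))// lerD//; last first.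
  have P8 : 0 <= 8 * B ^+ 2 * y ^+ 3.
    by apply: mulr_ge0; [have := sqr_ge0 B; lra|apply: exprn_ge0; exact: ltW].
  by rewrite normrM ger0_norm//; apply: ler_wpM2l.
have P4 : 0 <= 4 * B * (y * x).
  by apply: mulr_ge0; [lra|apply: mulr_ge0; exact: ltW].
rewrite normrM ler_pM// (le_trans (ler_normD _ _))// lerD//.
  rewrite /u 2!normrM (ger0_norm (x := 2))// (ger0_norm (x := 4 * B * (y * x))).
    have -> : 32 * B * (y * x) = 2 * (4 * B * (y * x) * 4) by ring.
    by rewrite ler_pM2l//; apply: ler_wpM2l.
  exact: P4.
apply: (le_trans hI); rewrite ler_wpM2l// expr2 ler_wpM2l ?(ltW y0)//.
by rewrite yx expr2; nra.
Qed.

End bessel.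

(** * Kesten-McKay moments *)

Section moments.
Variable R : realType.
Implicit Types (f g F G : R -> R) (a b x y z t q r : R) (k n : nat).

(* sin t * km_sin q n t / km_den q t is, up to constants, the spherical function
   at distance n times the Kesten-McKay weight, in the variable 2 sqrt q cos t. *)
Definition km_sin q n t : R :=
  (q - 1) * sin (n%:R * t) * cos t + (q + 1) * cos (n%:R * t) * sin t.

Definition km_sph q n t : R := 2 * q * sin t * km_sin q n t / km_den q t.

Lemma km_sph0 q t : km_sph q 0 t = km_weight q t.
Proof. by rewrite /km_sph /km_sin /km_weight mul0r sin0 cos0; ring. Qed.

Lemma sinSn n t :
  sin (n.+1%:R * t) = sin (n%:R * t) * cos t + cos (n%:R * t) * sin t.
Proof. by rewrite -natr1 mulrDl mul1r sinD. Qed.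

Lemma cosSn n t :
  cos (n.+1%:R * t) = cos (n%:R * t) * cos t - sin (n%:R * t) * sin t.
Proof. by rewrite -natr1 mulrDl mul1r cosD. Qed.

Lemma sin_sqrE t : sin t ^+ 2 = 1 - cos t ^+ 2.
Proof. by rewrite -(cos2Dsin2 t); ring. Qed.

Lemma km_sph_rec q n t :
  2 * cos t * km_sph q n.+1 t = km_sph q n t + km_sph q n.+2 t.
Proof.
rewrite /km_sph -mulrDl mulrA; congr (_ / _).
have -> : 2 * q * sin t * km_sin q n t + 2 * q * sin t * km_sin q n.+2 t =
  2 * q * sin t * (km_sin q n t + km_sin q n.+2 t) by ring.
suff <- : 2 * cos t * km_sin q n.+1 t = km_sin q n t + km_sin q n.+2 t by ring.
rewrite /km_sin !(sinSn n.+1) !(cosSn n.+1) !(sinSn n) !(cosSn n).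
have := sin_sqrE t.
move: (sin (n%:R * t)) (cos (n%:R * t)) (cos t) (sin t) => s c a b h.
apply/eqP; rewrite -subr_eq0; apply/eqP.
transitivity ((b ^+ 2 - (1 - a ^+ 2)) * (c * b + q * c * b + q * s * a - s * a)).
  by ring.
by rewrite h; ring.
Qed.

Lemma km_sph_rec0 q t : 2 * q * cos t * km_sph q 0 t = (q + 1) * km_sph q 1 t.
Proof. by rewrite /km_sph /km_sin !mul0r !mul1r sin0 cos0; ring. Qed.

(** Iterated, this expands [km_sph q n] into the sum over j of q^-j (cos((n+2j)t) - cos((n+2j+2)t)),
    a geometric expansion of 1 / [km_den] that makes the integral over [0, pi] accessible. *)
Lemma km_sph_telescope q n t : 1 < q ->
  km_sph q n t - q^-1 * km_sph q n.+2 t = cos (n%:R * t) - cos (n.+2%:R * t).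
Proof.
move=> q1; have dn0 : km_den q t != 0 by rewrite gt_eqF ?km_den_gt0.
have qn0 : q != 0 by rewrite gt_eqF//; lra.
rewrite /km_sph.
suff: 2 * sin t * (q * km_sin q n t - km_sin q n.+2 t) =
   (cos (n%:R * t) - cos (n.+2%:R * t)) * km_den q t.
  move=> h; rewrite -[RHS](mulfK dn0) -h; field; by rewrite qn0 dn0.
rewrite /km_sin /km_den !(sinSn n.+1) !(cosSn n.+1) !(sinSn n) !(cosSn n).
have := sin_sqrE t.
move: (sin (n%:R * t)) (cos (n%:R * t)) (cos t) (sin t) => s c a b h.
have e1 : b ^+ 3 = b * (1 - a ^+ 2) by rewrite -h; ring.
have e2 : b ^+ 4 = (1 - a ^+ 2) ^+ 2 by rewrite -h; ring.
ring: h e1 e2.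
Qed.

Lemma km_sin_le q n t : 1 < q -> `|km_sin q n t| <= 2 * q.
Proof.
move=> q1; rewrite (le_trans (ler_normD _ _))//.
have -> : 2 * q = (q - 1) * 1 * 1 + (q + 1) * 1 * 1 by ring.
rewrite !normrM !(ger0_norm (x := q - 1)) ?(ger0_norm (x := q + 1)); [|lra..].
by rewrite lerD// !ler_pM ?mulr_ge0 ?sin_norm_le1 ?cos_norm_le1//; lra.
Qed.

Lemma km_sph_continuous q n : 1 < q -> continuous (km_sph q n).
Proof.
move=> q1; have dn0 t : km_den q t != 0 by rewrite gt_eqF ?km_den_gt0.
by rewrite /km_sph /km_sin /km_den; continuous_tac; exact: dn0.
Qed.

Lemma sin_npi n : sin (n%:R * pi) = 0 :> R.
Proof.
elim: n => [|n IHn]; first by rewrite mul0r sin0.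
by rewrite sinSn IHn sinpi; ring.
Qed.

Lemma Int_cosn n : Int (fun t => cos (n%:R * t)) 0 pi = if n is 0 then pi else 0.
Proof.
case: n => [|n].
  rewrite (@Int_eq _ _ id); [by rewrite subr0|by continuous_tac|
    exact: lexx|exact: pi_ge0|].
  by move=> t _; rewrite mul0r cos0; exact: has_deriv_id.
rewrite (@Int_eq _ _ (fun t => n.+1%:R^-1 * sin (n.+1%:R * t)));
  [|by continuous_tac|exact: lexx|exact: pi_ge0|].
  by rewrite sin_npi !mulr0 sin0 mulr0 subrr.
have : n.+1%:R != 0 :> R by rewrite pnatr_eq0.
by move: n.+1%:R => c c0 t _; derive_tac; field.
Qed.

Lemma geometric_le_eq0 (u B y : R) : 0 <= y -> y < 1 ->
  (forall N, `|u| <= B * y ^+ N) -> u = 0.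
Proof.
move=> y0 y1 h; apply/eqP; rewrite -normr_le0.
have yn : `|y| < 1 by rewrite ger0_norm.
by apply: (cvgr_to_ge (@cvg_geometric R B y yn)); near=> N; exact: h.
Unshelve. all: by end_near. Qed.

(** For n >= 1 the cosine terms integrate to 0, so the integral equals q^-N times the one at n + 2N;
    these are uniformly bounded, which forces 0. For n = 0 only the constant cosine survives. *)
Lemma Int_km_sph q n : 1 < q ->
  Int (km_sph q n) 0 pi = if n is 0 then pi else 0.
Proof.
move=> q1; have q0 : 0 < q by lra.
have cn j : continuous (fun t : R => cos (j%:R * t)) by continuous_tac.
have csph j := @km_sph_continuous q j q1.
have pi0 := pi_ge0 R.
have step j : Int (km_sph q j) 0 pi = q^-1 * Int (km_sph q j.+2) 0 pi
    + Int (fun t => cos (j%:R * t)) 0 pi.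
  have := Int_lin 1 (- q^-1) (csph j) (csph j.+2) (lexx 0) pi0.
  have := Int_lin 1 (- 1) (cn j) (cn j.+2) (lexx 0) pi0.
  rewrite (Int_cosn j.+2) mulr0 addr0 mul1r => <-.
  rewrite (_ : (fun x => _) = (fun x => 1 * cos (j%:R * x) + -1 * cos (j.+2%:R * x))).
    by move=> ->; ring.
  by apply/funext => t; rewrite !mul1r mulN1r mulNr km_sph_telescope.
have IS0 j : Int (km_sph q j.+1) 0 pi = 0.
  pose B := 2 * q * (2 * q) / (q - 1) ^+ 2 * (pi - 0).
  apply: (@geometric_le_eq0 _ B q^-1); [by rewrite invr_ge0 ltW|by rewrite invf_lt1|].
  move=> N; elim: N j => [|N IHN] j.
    rewrite expr0 mulr1; apply: Int_le => // t _.
    have d0 : 0 < (q - 1) ^+ 2 by rewrite exprn_gt0// subr_gt0.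
    have dle : (q - 1) ^+ 2 <= km_den q t.
      have := sqr_ge0 (sin t); rewrite sin_sqrE /km_den; nra.
    rewrite /km_sph normrM normfV (gtr0_norm (km_den_gt0 _ q1)).
    rewrite ler_pM ?invr_ge0 ?(ltW (km_den_gt0 _ q1))//; last first.
      by rewrite lef_pV2// ?posrE ?km_den_gt0.
    rewrite normrM ler_pM//; last exact: km_sin_le.
    rewrite normrM ger0_norm ?mulr_ge0 ?(ltW q0)//.
    by rewrite ler_piMr ?sin_norm_le1// mulr_ge0// ltW.
  rewrite step Int_cosn addr0 normrM ger0_norm ?invr_ge0 ?(ltW q0)//.
  rewrite exprS mulrCA; apply: ler_wpM2l; first by rewrite invr_ge0 ltW.
  exact: IHN.
case: n => [|n]; last exact: IS0.
by rewrite step IS0 Int_cosn mulr0 add0r.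
Qed.

(** For r^2 = m - 1 this is the value of X^k delta_e at distance n from the root, that is, the
    number of walks of length k to such a vertex. *)
Definition km_moment r k n : R :=
  pi^-1 * Int (fun t => (2 * r * cos t) ^+ k * (r ^- n * km_sph (r ^+ 2) n t)) 0 pi.

(** * The recurrence of the moments in k *)

Section recurrence.
Variables (r : R) (r1 : 1 < r).
Let q1 : 1 < r ^+ 2. Proof. by rewrite exprn_egt1. Qed.
Let r0 : 0 < r. Proof. by rewrite (lt_trans _ r1). Qed.
Let rn0 : r != 0. Proof. by rewrite gt_eqF. Qed.

Let moment_cont k n : continuous
  (fun t => (2 * r * cos t) ^+ k * (r ^- n * km_sph (r ^+ 2) n t)).
Proof.
have c1 : continuous (fun t : R => (2 * r * cos t) ^+ k) by continuous_tac.
have c2 := @km_sph_continuous (r ^+ 2) n q1.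
by move=> t; exact: (cvgM (c1 t) (cvgM (cvg_cst (r ^- n)) (c2 t))).
Qed.

Lemma km_moment0 n : km_moment r 0 n = (n == 0)%:R.
Proof.
rewrite /km_moment; under eq_fun do rewrite expr0 mul1r.
rewrite Int_scale ?pi_ge0//; last exact: km_sph_continuous.
rewrite Int_km_sph//; case: n => [|n]; last by rewrite !mulr0.
by rewrite expr0 invr1 mul1r mulVf// gt_eqF ?pi_gt0.
Qed.

(** This and the next relation mirror the tree: the root has r^2 + 1 = m neighbours at distance 1,
    any other vertex one neighbour closer to the root and r^2 = m - 1 farther away. *)
Lemma km_momentS0 k : km_moment r k.+1 0 = (r ^+ 2 + 1) * km_moment r k 1.
Proof.
rewrite /km_moment mulrCA; congr (_ * _).
rewrite -Int_scale; [|exact: moment_cont|exact: lexx|exact: pi_ge0].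
congr Int; apply/funext => t.
transitivity ((2 * r * cos t) ^+ k
    * (r^-1 * (2 * r ^+ 2 * cos t * km_sph (r ^+ 2) 0 t))).
  by rewrite exprS expr0 invr1; field.
by rewrite km_sph_rec0 expr1; ring.
Qed.

Lemma km_momentSS k n :
  km_moment r k.+1 n.+1 = km_moment r k n + r ^+ 2 * km_moment r k n.+2.
Proof.
rewrite /km_moment mulrCA -mulrDr; congr (_ * _).
rewrite -[X in X + _]mul1r -Int_lin; [|exact: moment_cont|exact: moment_cont
  |exact: lexx|exact: pi_ge0].
congr Int; apply/funext => t.
have -> : km_sph (r ^+ 2) n t =
   2 * cos t * km_sph (r ^+ 2) n.+1 t - km_sph (r ^+ 2) n.+2 t.
  by rewrite km_sph_rec addrK.
by rewrite !exprS; field; rewrite rn0 expf_neq0.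
Qed.

Lemma km_moment_odd k n : odd (k + n) -> km_moment r k n = 0.
Proof.
elim: k n => [|k IHk] n; first by rewrite km_moment0; case: n.
case: n => [|n]; first by rewrite addn0 /= km_momentS0 => h; rewrite IHk ?mulr0 ?addn1.
rewrite km_momentSS addSn addnS /= negbK => h.
by rewrite !IHk ?mulr0 ?addr0// !addnS /= negbK.
Qed.

Definition return_amp t : R :=
  pi^-1 * Int (fun u => cos (2 * r * t * cos u) * km_weight (r ^+ 2) u) 0 pi.

End recurrence.

(** * The power series of the return amplitude in t *)

Lemma cos_coeffM x y k : cos_coeff (x * y) k = cos_coeff x k * y ^+ k.
Proof. by rewrite /cos_coeff /= exprMn; ring. Qed.

(** The tail is dominated by that of the exponential series at [z]; the uniformity in x permits
    termwise integration against the weight. *)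
Lemma cos_coeff_tail z : exists2 eps : R^nat, eps @ \oo --> 0 &
  forall n x, `|x| <= z -> `|cos x - series (cos_coeff x) n| <= eps n.
Proof.
exists (fun n => expR z - series (exp_coeff z) n).
  rewrite -[X in _ --> X](subrr (expR z)); apply: cvgB; first exact: cvg_cst.
  rewrite /expR; exact: is_cvg_series_exp_coeff.
move=> n x xz; have z0 : 0 <= z := le_trans (normr_ge0 _) xz.
have cvc : series (cos_coeff x) @ \oo --> cos x.
  by rewrite cos.unlock; exact: is_cvg_series_cos_coeff.
have cve : series (exp_coeff z) @ \oo --> expR z.
  by rewrite /expR; exact: is_cvg_series_exp_coeff.
suff: 0 <= expR z - series (exp_coeff z) n - `|cos x - series (cos_coeff x) n|.
  by rewrite subr_ge0.
have cvl : (fun N => series (exp_coeff z) N - series (exp_coeff z) n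
   - `|series (cos_coeff x) N - series (cos_coeff x) n|) @ \oo -->
   expR z - series (exp_coeff z) n - `|cos x - series (cos_coeff x) n|.
  apply: cvgB; first by apply: cvgB => //; exact: cvg_cst.
  by apply: cvg_norm; apply: cvgB => //; exact: cvg_cst.
apply: (cvgr_to_ge cvl); near=> N.
have nN : (n <= N)%N by near: N; exact: nbhs_infty_ge.
rewrite subr_ge0 !sub_series nN (le_trans (ler_norm_sum _ _ _))//.
apply: ler_sum => k _; rewrite /cos_coeff /exp_coeff /= normrM normfV normr_nat.
rewrite ler_pM2r ?invr_gt0 ?ltr0n ?fact_gt0// !normrM normrX normrN1 expr1n mulr1.
rewrite normrX normr_nat; case: odd => /=; first by rewrite mul0r exprn_ge0.
by rewrite mul1r lerXn2r ?nnegrE.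
Unshelve. all: by end_near. Qed.

Lemma cos_moment_series r t : 1 < r ->
  series (fun k => cos_coeff t k * km_moment r k 0) @ \oo --> return_amp r t.
Proof.
move=> r1; have q1 : 1 < r ^+ 2 by rewrite exprn_egt1.
have [eps eps0 heps] := cos_coeff_tail `|2 * r * t|.
have cw : continuous (km_weight (r ^+ 2) : R -> R).
  by have := @km_sph_continuous _ 0 q1; rewrite (funext (km_sph0 (r ^+ 2))).
have [M M0 hM] := continuous_bounded cw (pi_ge0 R).
pose A n u := series (cos_coeff (2 * r * t * cos u)) n * km_weight (r ^+ 2) u.
have AS n u : A n.+1 u = 1 * A n u
    + cos_coeff t n * ((2 * r * cos u) ^+ n * km_weight (r ^+ 2) u).
  rewrite /A seriesSr mulrDl mul1r; congr (_ + _).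
  by rewrite [RHS]mulrA -cos_coeffM; congr (cos_coeff _ _ * _); ring.
have cp n : continuous (fun u => (2 * r * cos u) ^+ n * km_weight (r ^+ 2) u).
  have c1 : continuous (fun u : R => (2 * r * cos u) ^+ n) by continuous_tac.
  by move=> u; exact: (cvgM (c1 u) (cw u)).
have cA n : continuous (A n).
  elim: n => [|n IHn].
    rewrite (_ : A 0 = fun=> 0); first by move=> u; exact: cvg_cst.
    by apply/funext => u; rewrite /A /series /= big_geq// mul0r.
  rewrite (funext (AS n)) => u.
  exact: (cvgD (cvgM (cvg_cst (1 : R)) (IHn u))
               (cvgM (cvg_cst (cos_coeff t n)) (cp n u))).
have pi0 := pi_ge0 R.
have E n : series (fun k => cos_coeff t k * km_moment r k 0) n =
    pi^-1 * Int (A n) 0 pi.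
  elim: n => [|n IHn].
    rewrite (@Int_eq _ _ (fun=> 0)); [|exact: cA|exact: lexx|exact: pi0|].
      by rewrite /series /= big_geq// subrr mulr0.
    move=> u _; rewrite /A /series /= big_geq// mul0r; exact: has_deriv_cst.
  rewrite (funext (AS n)) Int_lin; [|exact: cA|exact: cp|exact: lexx|exact: pi0].
  rewrite mul1r mulrDr -IHn seriesSr /km_moment.
  congr (_ + _); rewrite [LHS]mulrCA; congr (_ * (_ * _)).
  by congr Int; apply/funext => u; rewrite expr0 invr1 mul1r km_sph0.
have cc : continuous (fun u => cos (2 * r * t * cos u) * km_weight (r ^+ 2) u).
  have c1 : continuous (fun u : R => cos (2 * r * t * cos u)) by continuous_tac.
  by move=> u; exact: (cvgM (c1 u) (cw u)).
have bound n : `|return_amp r t - series (fun k => cos_coeff t k * km_moment r k 0) n|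
    <= eps n * M.
  rewrite E /return_amp -mulrBr normrM ger0_norm ?invr_ge0//.
  rewrite ler_pdivrMl ?pi_gt0// [leRHS]mulrC.
  have := Int_lin 1 (- 1) cc (cA n) (lexx 0) pi0.
  rewrite mul1r mulN1r => <-; rewrite -[X in _ <= _ * X]subr0; apply: Int_le => //.
    move=> u.
    exact: (cvgD (cvgM (cvg_cst (1 : R)) (cc u)) (cvgM (cvg_cst (- 1 : R)) (cA n u))).
  move=> u /hM wM; rewrite mul1r mulN1r /A -mulrBl normrM ler_pM//.
  by apply: heps; rewrite normrM ler_piMr// cos_norm_le1.
apply/cvgrPdist_le => e e0.
have cv : eps n * M @[n --> \oo] --> 0 * M by apply: cvgM => //; exact: cvg_cst.
rewrite mul0r in cv; have /cvgrPdist_le/(_ e e0) cve := cv.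
near=> n; apply: (le_trans (bound n)); apply: (le_trans (ler_norm _)).
by rewrite -normrN -sub0r; near: n.
Unshelve. all: by end_near. Qed.

End moments.

(** * Homogeneous trees *)

Section tree.
Variables (V : choiceType) (adj : rel V) (e : V) (m : nat).
Hypothesis hT : regular_tree adj m.

Let adj_sym : symmetric adj. Proof. by case: hT. Qed.
Let adj_irr : irreflexive adj. Proof. by case: hT. Qed.
Let adj_connected : graph_connected adj. Proof. by case: hT. Qed.
Let adj_acyclic : graph_acyclic adj. Proof. by case: hT. Qed.

Definition at_distance (v : V) (n : nat) : Prop :=
  exists p, [/\ path adj e p, last e p = v & size p = n].

Lemma at_distance_ex v : exists n, `[< at_distance v n >].
Proof.
by have [p [pp pv]] := adj_connected e v; exists (size p); apply/asboolP; exists p.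
Qed.

Definition tdist v := ex_minn (at_distance_ex v).

Lemma tdist_path v : at_distance v (tdist v).
Proof. by rewrite /tdist; case: ex_minnP => n /asboolP. Qed.

Lemma tdist_le p : path adj e p -> (tdist (last e p) <= size p)%N.
Proof.
move=> pp; rewrite /tdist; case: ex_minnP => n _; apply.
by apply/asboolP; exists p.
Qed.

Lemma tdist_adj v w : adj v w -> (tdist w <= (tdist v).+1)%N.
Proof.
move=> vw; have [p [pp pv <-]] := tdist_path v.
have := @tdist_le (rcons p w); rewrite last_rcons size_rcons; apply.
by rewrite rcons_path pp pv.
Qed.

Lemma tdist_root : tdist e = 0%N.
Proof. by apply/eqP; rewrite -leqn0; exact: (@tdist_le [::]). Qed.

Lemma tdist_eq0 v : tdist v = 0%N -> v = e.
Proof.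
move=> v0; have [p [_ pv ps]] := tdist_path v; move: pv.
by rewrite v0 in ps; rewrite (size0nil ps).
Qed.

Lemma tdist_parent v : (0 < tdist v)%N ->
  exists2 u, adj v u & tdist v = (tdist u).+1.
Proof.
have [p [pp pv ps]] := tdist_path v; rewrite -ps.
case/lastP: p pp pv ps => [//|p x]; rewrite rcons_path last_rcons size_rcons.
move=> /andP[pp px] xv ps _; rewrite {}xv in px.
exists (last e p); first by rewrite adj_sym.
by apply/eqP; rewrite eqSS eqn_leq tdist_le// andbT -ltnS ps tdist_adj.
Qed.

Lemma descending_path v : exists p,
  [/\ path adj v p, last v p = e & forall x, x \in p -> (tdist x < tdist v)%N].
Proof.
have [n] := ubnP (tdist v); elim: n v => // n IHn v; rewrite ltnS => vn.
have [v0|v0] := posnP (tdist v); first by exists [::]; split=> //; exact: tdist_eq0.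
have [u vu vE] := tdist_parent v0.
have [|p [pp pe pd]] := IHn u; first by rewrite -vE.
exists (u :: p); split => //=; first by rewrite vu.
move=> x; rewrite inE vE => /predU1P[->//|/pd/ltnW]; exact.
Qed.

(* Two such neighbours would be joined, through the root, by a path avoiding v,
   which closes up to a cycle through v. *)
Lemma lower_neighbour_unique v w w' : adj v w -> adj v w' ->
  (tdist w <= tdist v)%N -> (tdist w' <= tdist v)%N -> w = w'.
Proof.
move=> vw vw' dw dw'; apply/eqP/negPn/negP => ww'.
have avoid x p : adj v x -> (tdist x <= tdist v)%N ->
    (forall y, y \in p -> (tdist y < tdist x)%N) -> v \notin x :: p.
  move=> vx dx hp; rewrite inE negb_or; apply/andP; split.
    by apply/eqP => vx'; rewrite -vx' adj_irr in vx.
  by apply/negP => /hp; rewrite ltnNge dx.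
have [p [pp pe pd]] := descending_path w.
have [p' [pp' pe' pd']] := descending_path w'.
have vp := avoid _ _ vw dw pd; have vp' := avoid _ _ vw' dw' pd'.
pose q := p ++ rev (belast w' p').
have pq : path adj w q.
  rewrite cat_path pp pe -pe' rev_path /=.
  by rewrite (eq_path (e' := adj))// => x y; rewrite adj_sym.
have lq : last w q = w'.
  rewrite last_cat pe -pe'; case: (p') => [//|y s] /=.
  by rewrite rev_cons last_rcons.
have vq : v \notin w :: q.
  rewrite -cat_cons mem_cat negb_or vp mem_rev.
  by apply: contra vp' => /mem_belast.
(* The descending paths may meet before the root, so [q] is only a walk; shortening makes it simple
   and uses no new vertex, hence still avoids v. *)
case/shortenP: pq lq => s ps us sq ls.
have vs : v \notin w :: s.
  apply: contra vq; rewrite !inE => /predU1P[->|/sq ->]; rewrite ?eqxx//.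
  by rewrite orbT.
apply: (adj_acyclic (c := v :: w :: s)).
  (* As w and w' differ, [s] is nonempty, and the cycle has at least the three vertices required by
     [graph_acyclic]. *)
  by case: s ls {ps us sq vs} => [/= wE|//]; rewrite wE eqxx in ww'.
rewrite /ucycle /= vw rcons_path ps ls adj_sym vw' /=.
by rewrite vs.
Qed.

Lemma neighbour_seq v : exists s : seq V,
  [/\ uniq s, size s = m & forall w, (w \in s) = adj v w].
Proof.
have [_ _ _ _ /(_ v) cv] := hT.
have fv : finite_set [set w | adj v w] by exists m.
exists (finmap.enum_fset (fset_set [set w | adj v w])); split.
- exact: finmap.fset_uniq.
- exact: card_fset_set cv.
- move=> w; have -> := in_fset_set fv w.
  by apply/idP/idP => [/set_mem|/mem_set].
Qed.

(** * The adjacency operator on radial functions *)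

Section adjacency.
Variable R : realType.
Implicit Types (f : V -> R[i]) (v : V) (c : R[i]).

Definition neighbours v : seq V := projT1 (cid (neighbour_seq v)).

Lemma neighbours_uniq v : uniq (neighbours v).
Proof. by rewrite /neighbours; case: cid => s []. Qed.

Lemma size_neighbours v : size (neighbours v) = m.
Proof. by rewrite /neighbours; case: cid => s []. Qed.

Lemma mem_neighbours v w : (w \in neighbours v) = adj v w.
Proof. by rewrite /neighbours; case: cid => s []. Qed.

Lemma adjacencyE f v : adjacency adj f v = \sum_(w <- neighbours v) f w.
Proof.
rewrite (fsbig_seq _ _ (neighbours_uniq v)) /adjacency.
suff -> : [set w | adj v w] = [set` neighbours v] by [].
by apply/funext => w; rewrite /mkset mem_neighbours.
Qed.

Lemma adjacencyZ c f v :
  adjacency adj (fun w => c * f w) v = c * adjacency adj f v.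
Proof. by rewrite !adjacencyE mulr_sumr. Qed.

(** Uniqueness of the lower neighbour holds for a non-strict inequality, so it also excludes
    neighbours at equal distance: all but the parent lie one step farther. *)
Lemma adjacency_radial (g : nat -> R[i]) v : adjacency adj (fun w => g (tdist w)) v =
  if tdist v is n.+1 then g n + (m.-1)%:R * g n.+2 else m%:R * g 1.
Proof.
have up w : adj v w -> ~~ (tdist w <= tdist v)%N -> tdist w = (tdist v).+1.
  by move=> vw; rewrite -ltnNge => h; apply/eqP; rewrite eqn_leq tdist_adj.
have sum_cst (s : seq V) (c : R[i]) : \sum_(w <- s) c = (size s)%:R * c.
  by rewrite big_const_seq count_predT iter_addr_0 mulr_natl.
rewrite adjacencyE; have [v0|v0] := posnP (tdist v).
  rewrite v0 -[in RHS](size_neighbours v) -sum_cst; apply: eq_big_seq => w.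
  rewrite mem_neighbours => vw; rewrite up ?v0// leqn0.
  apply/eqP => /tdist_eq0 wE; move: vw.
  by rewrite wE (tdist_eq0 v0) adj_irr.
have [u vu uE] := tdist_parent v0.
rewrite uE (bigD1_seq u) ?mem_neighbours ?neighbours_uniq//=; congr (_ + _).
rewrite -(size_neighbours v) -[size _]/(size (neighbours v)).
have -> : (size (neighbours v)).-1 = size (rem u (neighbours v)).
  by rewrite size_rem// mem_neighbours.
rewrite -sum_cst rem_filter ?neighbours_uniq// big_filter.
rewrite big_seq_cond [RHS]big_seq_cond; apply: eq_bigr => w.
rewrite mem_neighbours => /andP[vw wu]; rewrite up// -?uE//.
apply: contra wu => wv; apply/eqP; apply: (lower_neighbour_unique vw vu wv).
by rewrite uE.
Qed.

Lemma delta_tdist v : delta R e v = (tdist v == 0%N)%:R.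
Proof.
rewrite /delta; congr (nat_of_bool _)%:R; apply/eqP/eqP => [->|/tdist_eq0//].
exact: tdist_root.
Qed.

Lemma adjacency_iter_delta (r : R) k v : 1 < r -> r ^+ 2 = m%:R - 1 ->
  iter k (adjacency adj) (delta R e) v = ((km_moment r k (tdist v))%:C)%C.
Proof.
move=> r1 r2; have m0 : (0 < m)%N.
  by rewrite lt0n; apply/eqP => m0; move: r2; rewrite m0 => r2; have := sqr_ge0 r; lra.
elim: k v => [|k IHk] v; first by rewrite /= delta_tdist km_moment0//; case: eqP.
rewrite /= (funext IHk) (adjacency_radial (fun n => ((km_moment r k n)%:C)%C)).
case: (tdist v) => [|n].
  by rewrite km_momentS0// r2 subrK [RHS]rmorphM rmorph_nat.
rewrite km_momentSS// r2 [RHS]rmorphD; congr (_ + _); rewrite [RHS]rmorphM.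
by congr (_ * _); rewrite rmorphB rmorph_nat rmorph1 -subn1 natrB.
Qed.

Lemma adjacency_mul_iter (c : R[i]) k f v :
  iter k (fun f v => c * adjacency adj f v) f v =
  c ^+ k * iter k (adjacency adj) f v.
Proof.
elim: k v => [|k IHk] v; first by rewrite expr0 mul1r.
by rewrite /= (funext IHk) adjacencyZ exprS mulrA.
Qed.

End adjacency.
End tree.

(** * The space l^2 *)

Section complex_square.
Variable R : realType.
Implicit Types x y z : R[i].

Definition normc2 x : R := Normc.normc x ^+ 2.

Lemma normc_ge0 x : 0 <= Normc.normc x.
Proof. by case: x => a b; exact: sqrtr_ge0. Qed.

Lemma normc2_ge0 x : 0 <= normc2 x. Proof. exact: sqr_ge0. Qed.

Lemma normc2E x : normc2 x = complex.Re x ^+ 2 + complex.Im x ^+ 2.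
Proof. by case: x => a b; rewrite /normc2 /= sqr_sqrtr// addr_ge0 ?sqr_ge0. Qed.

Lemma normc2M x y : normc2 (x * y) = normc2 x * normc2 y.
Proof. by rewrite /normc2 Normc.normcM exprMn. Qed.

Lemma normc2X x n : normc2 (x ^+ n) = normc2 x ^+ n.
Proof.
elim: n => [|n IHn]; first by rewrite !expr0 /normc2 Normc.normc1 expr1n.
by rewrite !exprS normc2M IHn.
Qed.

Lemma normc2_real (a : R) : normc2 (a%:C)%C = a ^+ 2.
Proof. by rewrite normc2E /= expr0n addr0. Qed.

Lemma ReD x y : complex.Re (x + y) = complex.Re x + complex.Re y.
Proof. by case: x y => [a b] [c d]. Qed.

Lemma ImD x y : complex.Im (x + y) = complex.Im x + complex.Im y.
Proof. by case: x y => [a b] [c d]. Qed.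

Lemma ReB x y : complex.Re (x - y) = complex.Re x - complex.Re y.
Proof. by case: x y => [a b] [c d]. Qed.

Lemma ImB x y : complex.Im (x - y) = complex.Im x - complex.Im y.
Proof. by case: x y => [a b] [c d]. Qed.

(** The cross term: (S y)^2 <= P Q y^2 = u w, so 2 |S y| <= u + w by the inequality of arithmetic
    and geometric means. *)
Lemma cauchy_schwarz_step (S P Q y p : R) : 0 <= P -> 0 <= Q -> 0 < p ->
  S ^+ 2 <= P * Q -> (S + y) ^+ 2 <= (P + p) * (Q + y ^+ 2 / p).
Proof.
move=> P0 Q0 p0 SPQ.
set u := P * (y ^+ 2 / p); set w := p * Q.
have u0 : 0 <= u by rewrite mulr_ge0// divr_ge0 ?sqr_ge0// ltW.
have w0 : 0 <= w by rewrite mulr_ge0// ltW.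
have uw : (S * y) ^+ 2 <= u * w.
  have -> : u * w = P * Q * y ^+ 2 by rewrite /u /w; field; rewrite gt_eqF.
  by rewrite exprMn ler_wpM2r ?sqr_ge0.
have -> : (P + p) * (Q + y ^+ 2 / p) = P * Q + y ^+ 2 + (u + w).
  by rewrite /u /w; field; rewrite gt_eqF.
have : `|2 * (S * y)| <= u + w.
  rewrite -ler_sqr ?nnegrE ?addr_ge0// real_normK ?num_real//.
  have := sqr_ge0 (u - w); nra.
by rewrite ler_norml => /andP[_ h]; rewrite sqrrD; lra.
Qed.

(* Cauchy-Schwarz with weights p, in the form that needs no square roots. *)
Lemma normc2_sum_le (I : Type) (s : seq I) (x : I -> R[i]) (p : I -> R) :
  (forall i, 0 < p i) ->
  normc2 (\sum_(i <- s) x i) <=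
  (\sum_(i <- s) p i) * (\sum_(i <- s) normc2 (x i) / p i).
Proof.
move=> p0; elim: s => [|i s IHs].
  by rewrite !big_nil mul0r /normc2 Normc.normc0 expr0n.
rewrite !big_cons ![_ + \sum_(j <- s) _]addrC.
have ps : 0 <= \sum_(i <- s) p i by apply: sumr_ge0 => j _; exact: ltW.
have qs : 0 <= \sum_(i <- s) normc2 (x i) / p i.
  by apply: sumr_ge0 => j _; rewrite divr_ge0 ?normc2_ge0// ltW.
apply: le_trans (cauchy_schwarz_step _ ps qs (p0 i) IHs).
by rewrite /normc2 lerXn2r ?nnegrE ?addr_ge0 ?normc_ge0// le_normcD.
Qed.

End complex_square.

Section ell2.
Variables (R : realType) (V : choiceType).
Implicit Types (f g : V -> R[i]) (K : R) (s : seq V).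

(** The condition that the squared l^2 norm is at most K, stated through finite sums so that the
    estimates stay in [R]. *)
Definition l2_bound f K := forall s, uniq s -> \sum_(v <- s) normc2 (f v) <= K.

Lemma l2_bound_ge0 f K : l2_bound f K -> 0 <= K.
Proof. by move=> /(_ [::] isT); rewrite big_nil. Qed.

Lemma l2_boundP f K :
  l2_bound f K <-> (\esum_(v in [set: V]) (Normc.normc (f v) ^+ 2)%:E <= K%:E)%E.
Proof.
split=> [fK|fK s us].
  apply: ge_ereal_sup => _ [A [fA _] <-].
  rewrite fsbig_finite//= sumEFin lee_fin; apply: fK; exact: finmap.fset_uniq.
rewrite -lee_fin; apply: le_trans fK; apply: esum_ge.
exists [set` s]; first by split.
by rewrite -fsbig_seq// sumEFin.
Qed.

Lemma l2P f : l2 f <-> exists K, l2_bound f K.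
Proof.
have E0 : (0 <= \esum_(v in [set: V]) (Normc.normc (f v) ^+ 2)%:E)%E.
  by apply: esum_ge0 => v _; rewrite lee_fin sqr_ge0.
rewrite /l2 /= /l2norm; split=> [/lty_poweRy|[K /l2_boundP fK]].
  rewrite invr_eq0 pnatr_eq0 => /(_ isT) lt.
  exists (fine (\esum_(v in [set: V]) (Normc.normc (f v) ^+ 2)%:E)).
  by apply/l2_boundP; rewrite fineK// ge0_fin_numE.
by apply: poweR_lty; apply: le_lt_trans fK _; rewrite ltry.
Qed.

Lemma l2norm_le f K : l2_bound f K -> (l2norm f <= (Num.sqrt K)%:E)%E.
Proof.
move=> fK; have K0 := l2_bound_ge0 fK; rewrite /l2norm -powR12_sqrt// -poweR_EFin.
apply: gt0_ler_poweR; [by rewrite invr_ge0| | |exact/l2_boundP].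
  rewrite in_itv /= leey andbT; apply: esum_ge0 => v _.
  by rewrite lee_fin sqr_ge0.
by rewrite in_itv /= leey lee_fin K0.
Qed.

Lemma l2norm_eq f : l2 f -> exists2 K, l2_bound f K &
  l2norm f = (Num.sqrt K)%:E.
Proof.
move=> lf; have E0 : (0 <= \esum_(v in [set: V]) (Normc.normc (f v) ^+ 2)%:E)%E.
  by apply: esum_ge0 => v _; rewrite lee_fin sqr_ge0.
have fin : \esum_(v in [set: V]) (Normc.normc (f v) ^+ 2)%:E \is a fin_num.
  rewrite ge0_fin_numE//; move: lf; rewrite /l2 /= /l2norm => /lty_poweRy; apply.
  by rewrite invr_eq0 pnatr_eq0.
exists (fine (\esum_(v in [set: V]) (Normc.normc (f v) ^+ 2)%:E)).
  by apply/l2_boundP; rewrite fineK.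
by rewrite /l2norm -powR12_sqrt ?fine_ge0// -poweR_EFin fineK.
Qed.

Lemma normc_le_l2norm f v : ((Normc.normc (f v))%:E <= l2norm f)%E.
Proof.
have -> : Normc.normc (f v) = (Normc.normc (f v) ^+ 2) `^ 2^-1.
  by rewrite powR12_sqrt ?sqr_ge0// sqrtr_sqr ger0_norm// normc_ge0.
rewrite -poweR_EFin /l2norm; apply: gt0_ler_poweR; [by rewrite invr_ge0|..].
- by rewrite in_itv /= leey lee_fin sqr_ge0.
- by rewrite in_itv /= leey andbT; apply: esum_ge0 => w _; rewrite lee_fin sqr_ge0.
apply: esum_ge; exists [set v]; first by split.
by rewrite fsbig_set1.
Qed.

Lemma delta_l2_bound e : l2_bound (delta R e) 1.
Proof.
move=> s us; rewrite (eq_bigr (fun v => (v == e)%:R)); last first.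
  move=> v _; rewrite /delta /normc2; case: eqP => _.
    by rewrite Normc.normc1 expr1n.
  by rewrite Normc.normc0 expr0n.
rewrite -natr_sum -[leRHS]/(1%:R) ler_nat.
rewrite (eq_bigr (fun v => if v == e then 1%N else 0%N)); last first.
  by move=> v _; case: eqP.
by rewrite -big_mkcond sum1_count (count_uniq_mem _ us) leq_b1.
Qed.

Lemma inner_delta e g : inner (delta R e) g = g e.
Proof.
have real_sum_pt (h : V -> R) : (forall v, v != e -> h v = 0) -> real_sum h = h e.
  move=> h0.
  have pt (k : V -> R) : (forall v, 0 <= k v) -> (forall v, v != e -> k v = 0) ->
      \esum_(v in [set: V]) (k v)%:E = (k e)%:E.
    move=> k0 kE; rewrite -(@esum_set1 _ _ e (fun v => (k v)%:E)) ?lee_fin//.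
    rewrite [RHS]esum_mkcond; apply: eq_esum => v _.
    case: ifPn => // /negP ve; rewrite kE//; apply/eqP => vE.
    by apply: ve; rewrite vE inE.
  rewrite /real_sum !pt.
  - rewrite -EFinB /=; have [h1|/ltW h1] := leP 0 (h e).
      have h2 : - h e <= 0 by rewrite oppr_le0.
      by rewrite (max_r h2) subr0.
    have h2 : 0 <= - h e by rewrite oppr_ge0.
    by rewrite (max_l h2) sub0r opprK.
  - by move=> v; rewrite le_max lexx orbT.
  - by move=> v /h0 ->; rewrite oppr0 maxxx.
  - by move=> v; rewrite le_max lexx orbT.
  - by move=> v /h0 ->; rewrite maxxx.
have c0 : conjc (0 : R[i]) = 0.
  by apply/eqP; rewrite eq_complex /= oppr0 !eqxx.
have c1 : conjc (1 : R[i]) = 1.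
  by apply/eqP; rewrite eq_complex /= oppr0 !eqxx.
rewrite /inner /complex_sum !real_sum_pt; last 2 first.
- by move=> v ve; rewrite /delta (negbTE ve) c0 mul0r.
- by move=> v ve; rewrite /delta (negbTE ve) c0 mul0r.
by rewrite /delta eqxx c1 mul1r; case: (g e).
Qed.

End ell2.

(** * The exponential of the adjacency operator *)

Section exponential.
Variables (R : realType) (V : choiceType) (adj : rel V) (m : nat).
Hypothesis hT : regular_tree adj m.
Hypothesis m_gt0 : (0 < m)%N.
Variable t : R.
Implicit Types (f g : V -> R[i]) (K : R) (s : seq V).

Let nbr := neighbours hT.

(** Cauchy-Schwarz over the m neighbours gives one factor m; by symmetry each vertex is a neighbour
    of at most m elements of [s], which gives the other. *)
Lemma adjacency_l2_bound f K :
  l2_bound f K -> l2_bound (adjacency adj f) (m%:R ^+ 2 * K).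
Proof.
move=> fK s us; pose U := undup (flatten [seq nbr v | v <- s]).
pose g w := normc2 (f w).
have nbrU v (h : V -> R) : v \in s ->
    \sum_(w <- nbr v) h w = \sum_(w <- U | adj v w) h w.
  move=> vs; rewrite -[RHS]big_filter; apply: perm_big; apply: uniq_perm.
  - exact: neighbours_uniq.
  - by rewrite filter_uniq// undup_uniq.
  - move=> w; rewrite mem_neighbours mem_filter mem_undup.
    case vw: (adj v w) => //=; apply/esym/flattenP.
    by exists (nbr v); [exact: map_f|rewrite mem_neighbours].
have step v : normc2 (adjacency adj f v) <= m%:R * \sum_(w <- nbr v) g w.
  rewrite (adjacencyE hT); have := normc2_sum_le (nbr v) f (fun=> ltr01).
  rewrite big_const_seq count_predT iter_addr_0 size_neighbours.
  by rewrite (eq_bigr (fun w => normc2 (f w)) (fun w _ => divr1 (normc2 (f w)))).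
apply: (le_trans (ler_sum _ (fun v _ => step v))).
rewrite -mulr_sumr expr2 -mulrA; apply: ler_wpM2l; first exact: ler0n.
rewrite (eq_big_seq (fun v => \sum_(w <- U | adj v w) g w)); last first.
  by move=> v vs; rewrite nbrU.
under eq_bigr do rewrite big_mkcond.
rewrite exchange_big /=.
apply: le_trans (_ : \sum_(w <- U) m%:R * g w <= _); last first.
  by rewrite -mulr_sumr; apply: ler_wpM2l; [exact: ler0n|exact/fK/undup_uniq].
apply: ler_sum => w _; rewrite -big_mkcond big_const_seq iter_addr_0.
rewrite mulr_natl -(size_neighbours hT w).
apply: ler_wpMn2l; first exact: normc2_ge0.
rewrite -size_filter; apply: uniq_leq_size; first exact: filter_uniq.
move=> v; rewrite mem_filter mem_neighbours => /andP[vw _].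
by case: hT => adj_sym _ _ _ _; rewrite adj_sym.
Qed.

Lemma iter_adjacency_l2_bound f K k :
  l2_bound f K -> l2_bound (iter k (adjacency adj) f) ((m%:R ^+ k) ^+ 2 * K).
Proof.
move=> fK; elim: k => [|k IHk]; first by rewrite expr0 expr1n mul1r.
by have := adjacency_l2_bound IHk; rewrite mulrA -exprMn -exprS.
Qed.

(** The summand 1 keeps [beta], and with it the Cauchy-Schwarz weights [p k], positive at t = 0. *)
Let beta : R := (`|t| + 1) * m%:R.
Let beta_gt0 : 0 < beta. Proof. by rewrite mulr_gt0 ?ltr0n// ltr_wpDl. Qed.
Let p k : R := exp_coeff beta k.
Let p_gt0 k : 0 < p k.
Proof. by rewrite /p /exp_coeff /= divr_gt0 ?exprn_gt0// ltr0n fact_gt0. Qed.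
Let A f v := 'i%C%C * (t%:C)%C * adjacency adj f v.
Let x f k v : R[i] := (k`!%:R)^-1 * iter k A f v.

Let A_iter f k v :
  iter k A f v = ('i%C * (t%:C)%C) ^+ k * iter k (adjacency adj) f v.
Proof. exact: (adjacency_mul_iter hT). Qed.

Lemma exp_term_l2_bound f K k : l2_bound f K -> l2_bound (x f k) (p k ^+ 2 * K).
Proof.
move=> fK s us; have K0 := l2_bound_ge0 fK.
have hk := iter_adjacency_l2_bound k fK us.
rewrite (eq_bigr (fun v => ((k`!%:R)^-1 * `|t| ^+ k) ^+ 2
   * normc2 (iter k (adjacency adj) f v))); last first.
  move=> v _; rewrite /x A_iter !normc2M normc2X normc2M normc2_real.
  have -> : normc2 ('i%C : R[i]) = 1 by rewrite normc2E /= expr0n expr1n add0r.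
  have -> : (k`!%:R : R[i])^-1 = ((k`!%:R^-1)%:C)%C.
    by rewrite fmorphV rmorph_nat.
  rewrite normc2_real mul1r mulrA [in RHS]exprMn; congr (_ * _ * _).
  by rewrite [RHS]exprAC real_normK ?num_real.
rewrite -mulr_sumr; apply: le_trans (ler_wpM2l (sqr_ge0 _) hk) _.
rewrite mulrA -exprMn; apply: ler_wpM2r => //.
have x0 : 0 <= k`!%:R^-1 * `|t| ^+ k * m%:R ^+ k :> R.
  by apply: mulr_ge0; [apply: mulr_ge0; rewrite ?invr_ge0 ?exprn_ge0|apply: exprn_ge0].
have xp : k`!%:R^-1 * `|t| ^+ k * m%:R ^+ k <= p k.
  rewrite /p /exp_coeff /= -mulrA mulrC -exprMn; apply: ler_wpM2r.
    by rewrite invr_ge0.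
  rewrite lerXn2r ?nnegrE ?mulr_ge0 ?addr_ge0// /beta.
  by apply: ler_wpM2r => //; rewrite lerDl.
by rewrite lerXn2r ?nnegrE//; exact: ltW.
Qed.

(** The triangle inequality in squared form: with weights p_k the k-th term contributes p_k^2 K /
    p_k = p_k K. *)
Lemma exp_segment_l2_bound f K n N : l2_bound f K ->
  l2_bound (fun v => \sum_(n <= k < N) x f k v) ((\sum_(n <= k < N) p k) ^+ 2 * K).
Proof.
move=> fK s us; set P := \sum_(n <= k < N) p k.
have P0 : 0 <= P by apply: sumr_ge0 => k _; exact: ltW.
apply: le_trans (_ : \sum_(v <- s) (P * \sum_(n <= k < N) normc2 (x f k v) / p k) <= _).
  by apply: ler_sum => v _; exact: normc2_sum_le.
rewrite -mulr_sumr expr2 -mulrA; apply: ler_wpM2l => //.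
rewrite exchange_big /= /P mulr_suml; apply: ler_sum => k _.
rewrite -mulr_suml ler_pdivrMr// mulrAC -expr2.
exact: exp_term_l2_bound.
Qed.

Let tau n : R := expR beta - series p n.

Let p_segment_le n N : (n <= N)%N -> \sum_(n <= k < N) p k <= tau n.
Proof.
move=> nN; have <- : series p N - series p n = \sum_(n <= k < N) p k.
  by rewrite sub_series nN.
rewrite /tau lerD2r; apply: nondecreasing_cvgn_le; last first.
  exact: is_cvg_series_exp_coeff.
by apply/nondecreasing_seqP => k; rewrite seriesSr lerDl ltW.
Qed.

Let tau_cvg : tau @ \oo --> 0.
Proof.
rewrite -[X in _ --> X](subrr (expR beta)); apply: cvgB; first exact: cvg_cst.
exact: is_cvg_series_exp_coeff.
Qed.

Let tau_ge0 n : 0 <= tau n.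
Proof. by have := p_segment_le (leqnn n); rewrite big_geq. Qed.

Let partialE f n v : opexp_partial A n f v = \sum_(0 <= k < n) x f k v.
Proof. by rewrite /opexp_partial big_mkord. Qed.

Let partialB f n N v : (n <= N)%N ->
  opexp_partial A N f v - opexp_partial A n f v = \sum_(n <= k < N) x f k v.
Proof.
move=> nN; rewrite !partialE.
by have := sub_series (fun k => x f k v) n N; rewrite nN.
Qed.

Let component_cvg (h : R[i] -> R) f K v : l2_bound f K ->
  (forall x y, h (x + y) = h x + h y) -> (forall x, h x ^+ 2 <= normc2 x) ->
  cvgn (fun n => h (opexp_partial A n f v)).
Proof.
move=> fK hD hle.
have h0 : h 0 = 0 by apply: (addrI (h 0)); rewrite -hD !addr0.
have -> : (fun n => h (opexp_partial A n f v)) = series (fun k => h (x f k v)).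
  apply/funext => n; rewrite partialE /series /=.
  exact: (big_morph h hD h0).
have K0 := l2_bound_ge0 fK.
have [c c0 cK] : exists2 c : R, 0 <= c & c ^+ 2 = K.
  by exists (Num.sqrt K); rewrite ?sqrtr_ge0 ?sqr_sqrtr.
have cvp : cvgn (series (c *: p)).
  by apply: is_cvg_seriesZ; exact: is_cvg_series_exp_coeff.
apply: normed_cvg; apply: (series_le_cvg _ _ _ cvp) => k //=.
  by apply: mulr_ge0 => //; exact: ltW.
have := exp_term_l2_bound k fK (s := [:: v]) isT; rewrite big_seq1 -cK => hk.
have cp0 : 0 <= c * p k by apply: mulr_ge0 => //; exact: ltW.
rewrite -[(c *: p) k]/(c * p k) -ler_sqr ?nnegrE//.
by rewrite real_normK ?num_real// exprMn mulrC; exact: le_trans (hle _) hk.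
Qed.

Let Re_le (y : R[i]) : complex.Re y ^+ 2 <= normc2 y.
Proof. by rewrite normc2E lerDl sqr_ge0. Qed.

Let Im_le (y : R[i]) : complex.Im y ^+ 2 <= normc2 y.
Proof. by rewrite normc2E lerDr sqr_ge0. Qed.

(** The candidate exponential, a pointwise limit. Outside l^2 its values are arbitrary, but [opnorm]
    tests l^2 vectors only. *)
Let U f v : R[i] := (limn (fun n => complex.Re (opexp_partial A n f v)) +i*
  limn (fun n => complex.Im (opexp_partial A n f v)))%C.

(** On a fixed finite [s] the segment bound holds for all N >= n, and N tends to infinity there. *)
Lemma exp_tail_l2_bound f K n : l2_bound f K ->
  l2_bound (fun v => U f v - opexp_partial A n f v) (tau n ^+ 2 * K).
Proof.
move=> fK s us; have K0 := l2_bound_ge0 fK.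
pose a N := \sum_(v <- s) normc2 (opexp_partial A N f v - opexp_partial A n f v).
have cva : a @ \oo --> \sum_(v <- s) normc2 (U f v - opexp_partial A n f v).
  rewrite /a; elim: s {us a} => [|v s IHs].
    under eq_fun do rewrite big_nil; rewrite big_nil; exact: cvg_cst.
  under eq_fun do rewrite big_cons; rewrite big_cons; apply: cvgD => //.
  have cRe := @component_cvg (@complex.Re R) f K v fK (@ReD R) Re_le.
  have cIm := @component_cvg (@complex.Im R) f K v fK (@ImD R) Im_le.
  rewrite normc2E ReB ImB; under eq_fun do rewrite normc2E ReB ImB.
  by apply: cvgD; rewrite expr2; under eq_fun do rewrite expr2;
    apply: cvgM; (apply: cvgB; [assumption|exact: cvg_cst]).
apply: (cvgr_to_le cva); near=> N.
have nN : (n <= N)%N by near: N; exact: nbhs_infty_ge.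
rewrite /a; under eq_bigr do rewrite partialB//.
apply: le_trans (exp_segment_l2_bound n N fK us) _.
apply: ler_wpM2r => //; rewrite lerXn2r ?nnegrE ?p_segment_le//.
by apply: sumr_ge0 => k _; exact: ltW.
Unshelve. all: by end_near. Qed.

Lemma opnorm_ge0 (B : (V -> R[i]) -> V -> R[i]) : (0 <= opnorm B)%E.
Proof. by apply: le_ereal_inf_tmp => _ [c [c0 _] <-]; rewrite lee_fin. Qed.

Lemma is_opexp_ex : is_opexp A U.
Proof.
have le (n : nat) :
    (opnorm (fun f v => (U f v - opexp_partial A n f v)%R) <= (tau n)%:E)%E.
  apply: ereal_inf_lbound; exists (tau n) => //; split => // f /l2norm_eq[K fK ->].
  have := l2norm_le (exp_tail_l2_bound n fK).
  by rewrite sqrtrM ?sqr_ge0// sqrtr_sqr ger0_norm// EFinM.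
apply: (@squeeze_cvge _ _ _ _ (fun=> 0%E) _ (fun n => (tau n)%:E)).
- by near=> n; rewrite opnorm_ge0 le.
- exact: cvg_cst.
- by apply/fine_cvgP; split; [near=> n|exact: tau_cvg].
Unshelve. all: by end_near. Qed.

(** [evolution] is a choice by [xget], so it is known only through [is_opexp]; convergence in
    operator norm is evaluated at one vector and one vertex. *)
Lemma evolution_cvg f v : l2_bound f 1 ->
  Normc.normc (evolution adj t f v - opexp_partial A n f v) @[n --> \oo] --> 0.
Proof.
move=> f1; have : is_opexp A (evolution adj t).
  exact: (@xgetPex _ _ (is_opexp A) (ex_intro _ U is_opexp_ex)).
rewrite /is_opexp => /fine_cvgP[fin /cvgrPdist_lt cv]; apply/cvgrPdist_le => r r0.
have {}cv := cv r r0; near=> n.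
pose B n f v := evolution adj t f v - opexp_partial A n f v.
have On_fin : opnorm (B n) \is a fin_num by near: n.
have : (opnorm (B n) < r%:E)%E.
  rewrite -(fineK On_fin) lte_fin (le_lt_trans (ler_norm _))//.
  by rewrite -normrN -sub0r; near: n.
move=> /ereal_inf_lt[_ [c [c0 hc] <-]]; rewrite lte_fin => cr.
rewrite sub0r normrN ger0_norm ?normc_ge0// -lee_fin.
apply: le_trans (normc_le_l2norm (B n f) v) _.
have /hc/le_trans : l2 f by apply/l2P; exists 1.
apply; rewrite -[r%:E]mule1.
apply: lee_pmul; [by []|exact: poweR_ge0|by rewrite lee_fin ltW|].
by rewrite -[1%E]/(1%:E) -(sqrtr1 R); exact: l2norm_le.
Unshelve. all: by end_near. Qed.

End exponential.

(** * The return probability *)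

Lemma powR_Nseven_half (R : realType) (t : R) : 0 < t ->
  t `^ (- (7 / 2)) = (t ^+ 3 * Num.sqrt t)^-1.
Proof.
move=> t0; rewrite powRN; congr (_^-1).
have -> : 7 / 2 = 3%:R + 2^-1 :> R by field.
rewrite powRD; last by rewrite gt_eqF// implybT.
by rewrite powR_mulrn ?ltW// powR12_sqrt// ltW.
Qed.

Lemma exp_term_even (R : realType) (t y : R) (k : nat) : (odd k -> y = 0) ->
  ((k`!%:R)^-1 * (('i%C * (t%:C)%C) ^+ k * (y%:C)%C) : R[i])
  = ((cos_coeff t k * y)%:C)%C.
Proof.
have -> : (k`!%:R : R[i])^-1 = ((k`!%:R^-1)%:C)%C by rewrite fmorphV rmorph_nat.
case: (boolP (odd k)) => [_ /(_ isT) ->|ek _]; first by rewrite !mulr0.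
rewrite /cos_coeff /= ek mul1r exprMn.
have -> : ('i%C : R[i]) ^+ k = (((-1) ^+ k./2)%:C)%C.
  rewrite -[in LHS](odd_double_half k) (negbTE ek) add0n -mul2n exprM.
  by rewrite rmorphXn rmorphN1 sqr_i.
rewrite -rmorphXn -!rmorphM; congr (_%:C)%C.
rewrite -[(-1 : R) ^ _]/((-1 : R) ^+ k./2); ring.
Qed.

(** Both sides are limits of the same partial sums: the k-th exponential term at the root is the
    k-th cosine coefficient times the moment, odd terms being zero. *)
Lemma return_amplitudeE (R : realType) (m : nat) (V : choiceType) (adj : rel V)
    (e : V) (r t : R) : regular_tree adj m -> 1 < r -> r ^+ 2 = m%:R - 1 ->
  return_amplitude adj e t = ((return_amp r t)%:C)%C.
Proof.
move=> hT r1 r2; have m0 : (0 < m)%N.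
  rewrite lt0n; apply/eqP => mE; move: r2; rewrite mE => r2.
  by have := sqr_ge0 r; lra.
rewrite /return_amplitude inner_delta.
pose S n := series (fun k => cos_coeff t k * km_moment r k 0) n.
have partialE n : opexp_partial (fun f v => 'i%C * (t%:C)%C * adjacency adj f v) n
    (delta R e) e = ((S n)%:C)%C.
  rewrite /opexp_partial /S /series /= big_mkord rmorph_sum; apply: eq_bigr => k _.
  rewrite (adjacency_mul_iter hT) (adjacency_iter_delta e hT k e r1 r2) tdist_root.
  by apply: exp_term_even => ok; apply: km_moment_odd; rewrite ?addn0.
have cv1 := evolution_cvg hT m0 t e (delta_l2_bound R e).
have cv2 := @cos_moment_series R r t r1.
apply/eqP; rewrite -subr_eq0; apply/eqP/Normc.eq0_normc/eqP.
rewrite eq_le normc_ge0 andbT.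
set z := evolution _ _ _ _ in cv1 *.
have cv : (fun n => Normc.normc (z - ((S n)%:C)%C) + `|S n - return_amp r t|)
    @ \oo --> 0 + `|return_amp r t - return_amp r t|.
  apply: cvgD; first by move: cv1; under eq_fun do rewrite partialE.
  by apply: cvg_norm; apply: cvgB => //; exact: cvg_cst.
rewrite subrr normr0 addr0 in cv.
apply: (cvgr_to_ge cv); near=> n.
have -> : z - ((return_amp r t)%:C)%C =
   (z - ((S n)%:C)%C) + ((S n - return_amp r t)%:C)%C.
  by rewrite rmorphB addrA subrK.
apply: le_trans (le_normcD _ _) _; rewrite lerD2l.
by rewrite /= expr0n addr0 sqrtr_sqr.
Unshelve. all: by end_near. Qed.

Unset Implicit Arguments.
Set Strict Implicit.
Set Printing Implicit Defensive.

Theorem mainTheorem8 (R : realType) (m : nat) (hm : (3 <= m)%N)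
    (V : choiceType) (adj : rel V) (e : V) (hT : regular_tree adj m) :
  exists2 C : R, 0 < C & \forall t \near +oo,
    `|return_probability adj e t
      - m%:R ^+ 2 * Num.sqrt (m%:R - 1) / (pi * (m%:R - 2) ^+ 4)
        * (t ^+ 3)^-1
        * sin (2 * Num.sqrt (m%:R - 1) * t - pi / 4) ^+ 2|
    <= C * t `^ (- (7 / 2)).
Proof.
have m3 : 3 <= m%:R :> R by rewrite ler_nat.
have : Num.sqrt (m%:R - 1) ^+ 2 = m%:R - 1 :> R by rewrite sqr_sqrtr//; lra.
have : 1 < Num.sqrt (m%:R - 1) :> R.
  by rewrite -[ltLHS]sqrtr1 ltr_sqrt; lra.
move: (Num.sqrt _) => r r1 r2.
have q1 : 1 < r ^+ 2 by rewrite r2; lra.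
have [K K0 hK] := km_transform_sqr q1.
exists (K + 1); first lra.
near=> t.
have t1 : 1 <= t by near: t; exact: nbhs_pinfty_ge.
have t0 : 0 < t by lra.
have z1 : 1 <= 2 * r * t by nra.
have tz : t <= 2 * r * t by nra.
have pi0 : 0 < pi :> R := pi_gt0 R.
rewrite /return_probability (@return_amplitudeE R m V adj e r t hT r1 r2).
rewrite -/(normc2 _) normc2_real.
have := hK _ z1; rewrite -/(return_amp r t).
(* With A = 2 r^2 m / (m - 2)^2, the constant 2 A^2 / (2 r)^3 is m^2 r / (m - 2)^4. *)
have -> : 2 * (2 * r ^+ 2 * (r ^+ 2 + 1) / (r ^+ 2 - 1) ^+ 2) ^+ 2
    / (pi * (2 * r * t) ^+ 3) * sin (2 * r * t - pi / 4) ^+ 2 =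
  m%:R ^+ 2 * r / (pi * (m%:R - 2) ^+ 4) * (t ^+ 3)^-1
    * sin (2 * r * t - pi / 4) ^+ 2.
  have -> : m%:R = r ^+ 2 + 1 by rewrite r2 subrK.
  have -> : r ^+ 2 + 1 - 2 = r ^+ 2 - 1 by ring.
  move: (sin _ ^+ 2) => s; move: pi pi0 => p p0.
  field; rewrite !gt_eqF//; lra.
move/le_trans; apply; rewrite powR_Nseven_half//.
have st0 : 0 < t ^+ 3 * Num.sqrt t by rewrite mulr_gt0 ?exprn_gt0 ?sqrtr_gt0.
(* Since 2 r t >= t, the error bound in z = 2 r t may be weakened to one in t. *)
apply: (@le_trans _ _ (K / (t ^+ 3 * Num.sqrt t))); last first.
  by apply: ler_wpM2r; [rewrite invr_ge0 ltW|lra].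
apply: ler_wpM2l => //; rewrite lef_pV2 ?posrE//; last first.
  by rewrite mulr_gt0 ?exprn_gt0 ?sqrtr_gt0//; lra.
apply: ler_pM; [by apply: exprn_ge0; exact: ltW|exact: sqrtr_ge0| |].
  by rewrite lerXn2r ?nnegrE//; lra.
by rewrite ler_sqrt; lra.
Unshelve. all: by end_near. Qed.
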